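(* Let $m\ge3$ be an integer. For every $Q\in X_2^m$ the $\mathrm{GL}(2,\mathbb{C})$-orbit of the associated form $\mathbf{Q}$ is closed in $Y_2^{2(m-2)}$.
   Context: All topological notions refer to the Zariski topology. $\mathcal{Q}_2^m$ is the complex vector space of binary forms (homogeneous polynomials) of degree $m$ on $\mathbb{C}^2$. $X_2^m$ ($m\ge3$) is the set of $Q\in\mathcal{Q}_2^m$ with non-zero discriminant, i.e. such that the partial derivatives $Q_1=\partial Q/\partial z_1$, $Q_2=\partial Q/\partial z_2$ have no common zero in $\mathbb{C}^2\setminus\{0\}$. Associated form: for $Q\in X_2^m$ let $M(Q):=\mathbb{C}[z_1,z_2]/(Q_1,Q_2)$ (the Milnor algebra). It is a local Artinian Gorenstein algebra; with $\mathfrak{m}$ its maximal ideal, $\mathrm{Soc}(M(Q)):=\{x\in\mathfrak{m}:x\mathfrak{m}=0\}$ is one-dimensional, equals $\mathfrak{m}^{2(m-2)}$, and is spanned by the element $e_0$ represented by the Hessian determinant $\mathrm{Hess}(Q)=\det(\partial^2Q/\partial z_i\partial z_j)$. Let $\omega:\mathrm{Soc}(M(Q))\to\mathbb{C}$ be the linear isomorphism with $\omega(e_0)=1$, and let $e_j$ be the element of $M(Q)$ represented by $z_j$. The associated form of $Q$ is $\mathbf{Q}\in\mathcal{Q}_2^{2(m-2)}$, $\mathbf{Q}(z):=\omega\left((z_1e_1+z_2e_2)^{2(m-2)}\right)$ for $z=(z_1,z_2)\in\mathbb{C}^2$. Catalecticant: for a binary form $P(z)=\sum_{j=0}^{2N}\binom{2N}{j}a_jz_1^{2N-j}z_2^j$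 of even degree $2N$, $\mathrm{Cat}(P):=\det(a_{i+j})_{0\le i,j\le N}$. For $N\ge1$, $Y_2^{2N}:=\{P\in\mathcal{Q}_2^{2N}:\mathrm{Cat}(P)\ne0\}$; every associated form of an element of $X_2^m$ lies in $Y_2^{2(m-2)}$. $\mathrm{GL}(2,\mathbb{C})$ acts on binary forms by $(C,P)\mapsto P_C$, $P_C(z):=P(z(C^{-1})^T)$, with $z$ a row vector. *)

(* Defs.v *)
From HB Require Import structures.
From mathcomp Require Import all_boot all_order all_algebra.
From mathcomp Require Import generic_quotient ring_quotient.
From mathcomp Require Import boolp classical_sets functions reals.
From mathcomp Require Import complex mpoly.

Set Implicit Arguments.
Unset Strict Implicit.
Unset Printing Implicit Defensive.

Import GRing.Theory.

Local Open Scope ring_scope.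
Local Open Scope classical_set_scope.
Local Open Scope quotient_scope.

(* The variables z_1, z_2 are 'X_0, 'X_1. *)
Notation binform K d := (dhomog 2 K d).

Section BinaryForms.
Variable K : fieldType.

Definition feval (p : {mpoly K[2]}) (z : 'rV[K]_2) : K := p.@[z 0].

(* P = \sum_j 'C(d, j) * bcoef P j * z_1^(d-j) * z_2^j (in characteristic 0) *)
Definition bcoef d (P : binform K d) (j : nat) : K :=
  (P : {mpoly K[2]})@_[multinom (if val i == 0 then d - j else j)%N | i < 2]
    / 'C(d, j)%:R.

(* Forms with non-zero discriminant. *)
Definition X2 m : set (binform K m) :=
  [set Q : binform K m | forall z : 'rV[K]_2,
     feval (Q : {mpoly K[2]})^`M(0) z = 0 ->
     feval (Q : {mpoly K[2]})^`M(1) z = 0 -> z = 0].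

Definition Cat N (P : binform K (2 * N)) : K :=
  \det (\matrix_(i < N.+1, j < N.+1) bcoef P (i + j)).

Definition Y2 N : set (binform K (2 * N)) := [set P : binform K (2 * N) | Cat P != 0].

(* P_C is determined by its values since K is infinite where this is used. *)
Definition GL2_orbit d (P : binform K d) : set (binform K d) :=
  [set P' : binform K d | exists2 C : 'M[K]_2, C \in unitmx &
     forall z : 'rV[K]_2, feval P' z = feval P (z *m (invmx C)^T)].

(* Zariski topology of the (d+1)-dimensional vector space of forms: closed sets
   are the zero loci of families of polynomials in the linear coordinates
   bcoef P 0, ..., bcoef P d. *)
Definition zariski_closed d (Z : set (binform K d)) : Prop :=
  exists S : set {mpoly K[d.+1]},
    Z = [set P : binform K d | forall f, S f -> f.@[fun j : 'I_d.+1 => bcoef P j] = 0].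

Definition zariski_closed_in d (Y A : set (binform K d)) : Prop :=
  exists2 Z, zariski_closed Z & A = Z `&` Y.

End BinaryForms.

Arguments X2 : clear implicits.
Arguments Y2 : clear implicits.

Section MilnorAlgebra.
Variables (K : fieldType) (m : nat) (hm : (3 <= m)%N) (Q : binform K m).

(* The ideal (Q_1, Q_2). The argument hm makes it proper (Q_1 and Q_2 vanish at
   the origin), as the quotient construction requires. *)
Definition milnor_ideal of (3 <= m)%N : {pred {mpoly K[2]}} :=
  [pred p | `[< exists a b : {mpoly K[2]},
     p = a * (Q : {mpoly K[2]})^`M(0) + b * (Q : {mpoly K[2]})^`M(1) >]].

Local Notation I := (milnor_ideal hm).

Lemma milnor_ideal_closed : idealr_closed I.
Proof.
have dQ0 (i : 'I_2) : ((Q : {mpoly K[2]})^`M(i))@_0%MM = 0.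
  rewrite mcoeff_deriv add0m (dhomog_nemf_coeff (dhomog_is_dhomog Q)) ?mul0rn //=.
  by rewrite mdeg1; case: (m) hm => [|[]].
split.
- by apply/asboolP; exists 0, 0; rewrite !mul0r addr0.
- apply/asboolP => -[a [b /(congr1 (mcoeff 0%MM))]].
  rewrite mcoeffD !rmorphM /= !dQ0 !mulr0 addr0 mcoeff1 eqxx.
  by move/eqP; rewrite oner_eq0.
- move=> c p q /asboolP[a [b ->]] /asboolP[a' [b' ->]]; apply/asboolP.
  exists (c * a + a'), (c * b + b').
  by rewrite mulrDr !mulrA !mulrDl addrACA.
Qed.

HB.instance Definition _ := isIdealr.Build _ I milnor_ideal_closed.

Definition milnor := {ideal_quot I}.

Definition mclass (p : {mpoly K[2]}) : milnor := \pi_{ideal_quot I} p.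

(* The maximal ideal of a local ring: its non-invertible elements. *)
Definition milnor_max : set milnor := [set x | ~ exists y, x * y = 1].

Definition milnor_soc : set milnor :=
  [set x | milnor_max x /\ forall y, milnor_max y -> x * y = 0].

Definition Hess : {mpoly K[2]} :=
  \det (\matrix_(i < 2, j < 2) (Q : {mpoly K[2]})^`M(i)^`M(j)).

(* The scalar c acts on the Milnor algebra as multiplication by mclass c%:MP. *)
Definition is_socle_form (w : milnor -> K) : Prop :=
  [/\ forall c x y, milnor_soc x -> milnor_soc y ->
        w (mclass c%:MP * x + y) = c * w x + w y,
      set_bij milnor_soc [set: K] w
    & w (mclass Hess) = 1].

(* For Q in X2 the restriction of omega to the socle is the unique isomorphism
   with value 1 on the Hessian; only this restriction is used below. *)
Definition omega : milnor -> K := xget (fun=> 0) [set w | is_socle_form w].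

Definition assoc_form : binform K (2 * (m - 2)) :=
  xget 0 [set P : binform K (2 * (m - 2)) | forall z : 'rV[K]_2,
    feval P z =
      omega ((mclass (z 0 0)%:MP * mclass 'X_0 + mclass (z 0 1)%:MP * mclass 'X_1)
               ^+ (2 * (m - 2)))].

End MilnorAlgebra.

(* Main.v *)
(* Write N = m - 2 and dehomogenize binary forms by x = z_1 / z_2.  A form P of
   degree 2N defines a functional T_P on forms of degree 2N, with
   P(z) = T_P((z_1 x + z_2)^(2N)), and Cat(P) <> 0 says that the pairing
   (g, h) |-> T_P(g h) on forms of degree N is non-degenerate; hence such a P has
   no root of multiplicity > N.  For the associated form F of Q, the kernel of
   T_F is the degree 2N part of the ideal (Q_1, Q_2), and Gorenstein duality holds
   for this complete intersection.  If F has a root of multiplicity N, duality puts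
   an N+1-st power of a linear form into span(Q_1, Q_2).  Euler's identity then
   produces a second such power, and F is a constant times the N-th power of a
   product of two linear forms.

   To separate P from the orbit of F, let r be the roots of F and l those of P,
   in some order.  The conditions that r_i = r_j implies l_i = l_j, and that all cross-ratio
   equations between l and r hold, are polynomial in l and hold on the orbit.
   Multiplying a generic combination of them over all orderings of l gives a
   symmetric function of l, hence a polynomial in the coefficients of P.  If it
   vanishes for all generic combinations, the conditions hold for one ordering.  When l
   takes three distinct values, l and r are then related by a Moebius map.
   Otherwise l takes two values N times each, r is constant on one of the two
   blocks, and the previous paragraph makes r constant on the other one too. *)
From HB Require Import structures.
Require Import Defs.
From mathcomp Require Import all_boot all_order all_algebra all_fingroup.
From mathcomp Require Import classical_sets reals complex mpoly.
From mathcomp Require Import boolp ring_quotient zify ring.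

Set Implicit Arguments.
Unset Strict Implicit.
Unset Printing Implicit Defensive.

Import Order.TTheory GRing.Theory Num.Theory.

Local Open Scope ring_scope.

(** * Pencils of binary forms and the gradient pencil *)

Section BinaryPencil.
Variable K : numClosedFieldType.
Implicit Types a b f g h p : {poly K}.

(* The degree [d] part of the ideal generated by two forms of degree [n], all dehomogenized; the truncated [d.+1 - n] makes it zero for [d < n]. *)
Definition pencil_ideal n f g d p : Prop :=
  exists a b, [/\ (size a <= d.+1 - n)%N, (size b <= d.+1 - n)%N & p = a * f + b * g].

Lemma size_mulX_leq a k : (size a <= k)%N -> (size ('X * a)%R <= k.+1)%N.
Proof.
have [->|a0] := eqVneq a 0; first by rewrite mulr0 size_poly0.
by rewrite mulrC size_mulX.
Qed.

Lemma pencil_idealD n f g d p p' :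
  pencil_ideal n f g d p -> pencil_ideal n f g d p' -> pencil_ideal n f g d (p + p').
Proof.
move=> [a [b [sa sb ->]]] [a' [b' [sa' sb' ->]]]; exists (a + a'), (b + b'); split.
- by rewrite (leq_trans (size_polyD _ _)) // geq_max sa.
- by rewrite (leq_trans (size_polyD _ _)) // geq_max sb.
- by ring.
Qed.

Lemma pencil_idealZ n f g d c p :
  pencil_ideal n f g d p -> pencil_ideal n f g d (c *: p).
Proof.
move=> [a [b [sa sb ->]]]; exists (c *: a), (c *: b); split.
- exact: leq_trans (size_scale_leq _ _) sa.
- exact: leq_trans (size_scale_leq _ _) sb.
- by rewrite scalerDr !scalerAl.
Qed.

Lemma pencil_ideal0 n f g d : pencil_ideal n f g d 0.
Proof. by exists 0, 0; rewrite size_poly0; split=> //; ring. Qed.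

Lemma pencil_idealN n f g d p :
  pencil_ideal n f g d p -> pencil_ideal n f g d (- p).
Proof. by move/(pencil_idealZ (-1)); rewrite scaleN1r. Qed.

Lemma pencil_ideal_small n f g d p : (d < n)%N -> pencil_ideal n f g d p -> p = 0.
Proof.
move=> dn [a [b []]]; rewrite (eqP (dn : d.+1 - n == 0)%N) !leqn0 !size_poly_eq0.
by move=> /eqP -> /eqP -> ->; ring.
Qed.

Lemma pencil_ideal_mulX n f g d p :
  pencil_ideal n f g d p -> pencil_ideal n f g d.+1 ('X * p).
Proof.
have [dn /(pencil_ideal_small dn) ->|dn] := ltnP d n.
  by rewrite mulr0; exact: pencil_ideal0.
move=> [a [b [sa sb ->]]]; exists ('X * a), ('X * b).
have -> : (d.+2 - n = (d.+1 - n).+1)%N by lia.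
split; [exact: size_mulX_leq|exact: size_mulX_leq|ring].
Qed.

Lemma pencil_ideal_succ n f g d p :
  pencil_ideal n f g d p -> pencil_ideal n f g d.+1 p.
Proof.
move=> [a [b [sa sb ->]]]; exists a, b; split=> //.
- by rewrite (leq_trans sa) // leq_sub2r.
- by rewrite (leq_trans sb) // leq_sub2r.
Qed.

(** * Pencils of two forms without common zeros *)

Section Regular.
Variables (n : nat) (f g : {poly K}).
Hypotheses (cfg : coprimep f g) (fgn : (f`_n != 0) || (g`_n != 0)).

(** [cfg] excludes an affine common zero and [fgn] one at infinity. The generator with non-zero
    coefficient at [n] has size above [n], yet by coprimality it divides a cofactor of size at most
    [n], which must vanish. *)
Lemma pencil_syzygy a b :
  (size a <= n)%N -> (size b <= n)%N -> a * f = b * g -> a = 0 /\ b = 0.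
Proof.
have key (u v x y : {poly K}) : coprimep u v -> v`_n != 0 ->
    (size x <= n)%N -> x * u = y * v -> x = 0 /\ y = 0.
  move=> cuv vn sx e.
  have vx : v %| x.
    by move: cuv; rewrite coprimep_sym => /(Gauss_dvdpl x) <-; rewrite e dvdp_mull.
  have x0 : x = 0.
    apply/eqP/negP => /negP x0; move: (dvdp_leq x0 vx).
    rewrite leqNgt (leq_ltn_trans sx) //.
    by rewrite ltnNge; apply: contra vn => /leq_sizeP/(_ n (leqnn n))/eqP.
  split=> //; move/eqP: e; rewrite x0 mul0r eq_sym mulf_eq0 => /orP[/eqP//|/eqP v0].
  by rewrite v0 coef0 eqxx in vn.
move=> sa sb e; case/orP: fgn => nz.
- by have [] := @key g f b a _ nz sb (esym e); rewrite // coprimep_sym.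
- exact: key e.
Qed.

(** As forms of degree [d.+1], [p] and ['X * p] are z_2 p and z_1 p. Their representations differ by
    a syzygy too small to be non-zero, so ['X * a = a'], and the bound on [a'] improves the one on
    [a]. *)
Lemma pencil_ideal_descent d p : (d.+2 < n + n)%N ->
  pencil_ideal n f g d.+1 p -> pencil_ideal n f g d.+1 ('X * p) -> pencil_ideal n f g d p.
Proof.
move=> dn [a [b [sa sb e]]] [a' [b' [sa' sb' e']]].
have sz (u v : {poly K}) : (size u <= d.+2 - n -> size v <= d.+2 - n ->
    size ('X * u - v)%R <= n)%N.
  move=> su sv; rewrite (leq_trans (size_polyD _ _)) // geq_max size_polyN.
  have h : (d.+2 - n < n)%N by lia.
  by rewrite (leq_trans (size_mulX_leq su)) // (leq_trans sv) // ltnW.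
have [|||xa xb] := @pencil_syzygy ('X * a - a') (b' - 'X * b).
- exact: sz.
- by rewrite -opprB size_polyN sz.
- apply/eqP; rewrite -subr_eq0; apply/eqP.
  have -> : ('X * a - a') * f - (b' - 'X * b) * g = 'X * (a * f + b * g) - (a' * f + b' * g).
    by ring.
  by rewrite -e -e' subrr.
have low (u : {poly K}) : (size ('X * u)%R <= d.+2 - n)%N -> (size u <= d.+1 - n)%N.
  have [->|u0] := eqVneq u 0; first by rewrite size_poly0.
  by rewrite mulrC size_mulX //; lia.
exists a, b; split=> //; apply: low.
- by rewrite (subr0_eq xa).
- by rewrite -(subr0_eq xb).
Qed.
End Regular.

Lemma pencil_idealM n f g d e p h : (size h <= e.+1)%N ->
  pencil_ideal n f g d p -> pencil_ideal n f g (d + e) (p * h).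
Proof.
move=> sh [a [b [sa sb ->]]]; exists (a * h), (b * h).
have sz (u : {poly K}) : (size u <= d.+1 - n)%N -> (size (u * h)%R <= (d + e).+1 - n)%N.
  have [->|u0] := eqVneq u 0; first by rewrite mul0r size_poly0.
  move=> su; rewrite (leq_trans (size_polyMleq _ _)) //.
  by move: u0; rewrite -size_poly_gt0; lia.
by split; [exact: sz|exact: sz|ring].
Qed.

Lemma poly_inj_surj k (phi : 'rV[K]_k -> {poly K}) : linear phi ->
  (forall v, (size (phi v) <= k)%N) -> (forall v, phi v = 0 -> v = 0) ->
  forall p, (size p <= k)%N -> exists v, phi v = p.
Proof.
move=> lphi sphi iphi.
pose L : {linear 'rV[K]_k -> {poly K}} := HB.pack phi (GRing.isLinear.Build _ _ _ _ phi lphi).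
pose M := lin1_mx (poly_rV \o L : 'rV[K]_k -> 'rV[K]_k).
have LM v : v *m M = poly_rV (phi v) by rewrite mul_rV_lin1.
have Mu : M \in unitmx.
  rewrite -row_free_unit -kermx_eq0; apply/eqP/row_matrixP => i; rewrite row0.
  apply: iphi; rewrite -[LHS](poly_rV_K (sphi _)) -LM -row_mul mulmx_ker row0.
  by rewrite linear0.
move=> p sp; exists (poly_rV p *m invmx M).
by rewrite -[LHS](poly_rV_K (sphi _)) -LM mulmxKV // poly_rV_K.
Qed.

Lemma poly_behead k p : (size p <= k.+1)%N ->
  exists c p', (size p' <= k)%N /\ p = c%:P + 'X * p'.
Proof.
elim/poly_ind: p => [|p c _].
  by exists 0, 0; rewrite size_poly0 mulr0 addr0.
rewrite size_MXaddC; case: ifP => [/andP[/eqP-> /eqP->] _|_ sp].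
  by exists 0, 0; rewrite size_poly0 mulr0 mul0r addr0.
by exists c, p; split=> //; rewrite mulrC addrC.
Qed.

(* The equation says that the form of degree [n] dehomogenizing to [G] is constant along the direction [(al, be)]. *)
Lemma euler_ode_sol n (al be : K) G : (al != 0) || (be != 0) ->
  (al%:P - be *: 'X) * G^`() + (be *: G) *+ n = 0 ->
  exists e, G = e *: (be *: 'X - al%:P) ^+ n.
Proof.
move=> ab0 odeG; set W := be *: 'X - al%:P.
have odeW : (al%:P - be *: 'X) * (W ^+ n)^`() + (be *: W ^+ n) *+ n = 0.
  have -> : al%:P - be *: 'X = - W by rewrite opprB.
  rewrite deriv_exp; have -> : W^`() = be%:P.
    by rewrite derivB derivZ derivX derivC subr0 -alg_polyC.
  case: (n) => [|k]; first by rewrite !mulr0n addr0 mulr0.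
  by rewrite /= -!mul_polyC exprS; ring.
have odeD e : (al%:P - be *: 'X) * (G - e *: W ^+ n)^`() + (be *: (G - e *: W ^+ n)) *+ n = 0.
  rewrite derivB derivZ -[RHS]subr0 -[X in _ = X - _]odeG -[X in _ = _ - X](mulr0 e%:P) -odeW.
  by rewrite -!mul_polyC; ring.
(* The coefficients of the difference obey a two-term recursion. For [al != 0] it carries zero
   upwards from the constant coefficient; for [al = 0] it kills all coefficients but the one at [n].
   The choice of [e] cancels the remaining one. *)
have coefD e k : (G - e *: W ^+ n)`_k.+1 * (al *+ k.+1) = (G - e *: W ^+ n)`_k * be * (k%:R - n%:R).
  move: (odeD e); move: (G - _) => D /(congr1 (fun p : {poly K} => p`_k)).
  rewrite -!mul_polyC mulrBl -(mulrA be%:P) coefD coefB !coefCM coefXM !coef_deriv.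
  rewrite coefMn coefCM coef0; case: k => [|k] /= e0;
    by apply/eqP; rewrite -subr_eq0 -[X in _ == X]e0; apply/eqP; ring.
have [a0|a0] := eqVneq al 0; last first.
  exists (G`_0 / (- al) ^+ n); set e := _ / _.
  apply/eqP; rewrite -subr_eq0; apply/eqP/polyP => k; rewrite coef0.
  elim: k => [|k IH].
    rewrite coefB coefZ -!horner_coef0 horner_exp /W hornerD hornerN hornerC hornerZ hornerX mulr0 add0r /e.
    have al0 : (- al) ^+ n != 0 by rewrite expf_neq0 // oppr_eq0.
    by rewrite divfK // horner_coef0 subrr.
  move: (coefD e k); rewrite IH !mul0r => /eqP; rewrite mulf_eq0 mulrn_eq0 (negbTE a0) /=.
  by rewrite orbF => /eqP.
move: ab0; rewrite a0 eqxx /= => b0.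
exists (G`_n / be ^+ n); set e := _ / _.
apply/eqP; rewrite -subr_eq0; apply/eqP/polyP => k; rewrite coef0.
have [->|kn] := eqVneq k n.
  rewrite coefB coefZ /W a0 subr0 exprZn coefZ coefXn eqxx mulr1 /e divfK ?subrr //.
  by rewrite expf_neq0.
move/eqP: (coefD e k); rewrite a0 mul0rn mulr0 eq_sym !mulf_eq0 (negbTE b0) orbF.
by rewrite subr_eq0 eqr_nat (negbTE kn) orbF => /eqP.
Qed.

Lemma size_mulS_leq d e (u v : {poly K}) :
  (size u <= d.+1)%N -> (size v <= e)%N -> (size (u * v)%R <= d + e)%N.
Proof. by move=> su sv; rewrite (leq_trans (size_polyMleq _ _)) //; lia. Qed.

Lemma size_linear_leq (s r : K) : (size (s%:P + r *: 'X)%R <= 2)%N.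
Proof.
rewrite (leq_trans (size_polyD _ _)) // geq_max (leq_trans (size_polyC_leq1 _)) //.
by rewrite (leq_trans (size_scale_leq _ _)) ?size_polyX.
Qed.

Lemma size_linear_exp_leq k (u : {poly K}) : (size u <= 2)%N -> (size (u ^+ k)%R <= k.+1)%N.
Proof. by move=> su; rewrite (leq_trans (size_poly_exp_leq _ _)) //; nia. Qed.

Section Gradient.
(* [f] and [g] are the dehomogenized partial derivatives of the form of degree [N.+2] given by [q]. *)
Variables (N : nat) (q : {poly K}).
Hypotheses (N1 : (0 < N)%N) (sq : (size q <= N.+3)%N).
Let n := N.+1.
Let f := q^`().
Let g := q *+ n.+1 - 'X * q^`().
Hypotheses (cfg : coprimep f g) (fgn : (f`_n != 0) || (g`_n != 0)).
Local Notation I := (pencil_ideal n f g).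

(* By Euler's identity the Hessian of a form with partials [f], [g] of degree [n] dehomogenizes to [n] times this. *)
Definition wronskian f g := f^`() * g - f * g^`().
Local Notation J := (wronskian f g).

Lemma size_deriv_leq k p : (size p <= k.+1)%N -> (size p^`() <= k)%N.
Proof.
move=> sp; apply/leq_sizeP => j kj; rewrite coef_deriv nth_default ?mul0rn //.
exact: leq_trans sp _.
Qed.

Lemma size_euler_leq k p : (size p <= k.+1)%N -> (size (p *+ k - 'X * p^`())%R <= k)%N.
Proof.
move=> sp; apply/leq_sizeP => j kj; rewrite coefB coefMn coefXM coef_deriv.
case: j kj => [|j] /= kj.
  by move: kj; rewrite leqn0 => /eqP ->; rewrite mulr0n subr0.
have [->|nkj] := eqVneq k j.+1; first by rewrite subrr.
rewrite nth_default ?mul0rn ?subrr //.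
by rewrite (leq_trans sp) // ltn_neqAle nkj kj.
Qed.

Lemma size_grad1 : (size f <= n.+1)%N. Proof. exact: size_deriv_leq. Qed.
Lemma size_grad2 : (size g <= n.+1)%N. Proof. exact: size_euler_leq. Qed.

(** Together with [wronskian_mulX] this makes [J] a socle element: both variables multiply it into
    the ideal. Here the cofactors are derivatives in z_1, there derivatives in z_2, obtained by
    Euler's identity. *)
Lemma wronskian_succ : I (N + N).+1 J.
Proof.
exists (- g^`()), f^`(); split; last by rewrite /wronskian; ring.
- by rewrite size_polyN (leq_trans (size_deriv_leq size_grad2)) // /n; lia.
- by rewrite (leq_trans (size_deriv_leq size_grad1)) // /n; lia.
Qed.

Lemma wronskian_mulX : I (N + N).+1 ('X * J).
Proof.
exists (g *+ n - 'X * g^`()), (- (f *+ n - 'X * f^`())); split.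
- by rewrite (leq_trans (size_euler_leq size_grad2)) // /n; lia.
- by rewrite size_polyN (leq_trans (size_euler_leq size_grad1)) // /n; lia.
- by rewrite /wronskian; ring.
Qed.

(** Comparing a representation in degree 2N with the definition of [J] gives a syzygy of size at
    most [n], hence zero. The derivatives of [f] and [g] then have size at most N, so both
    coefficients at [n] vanish, against [fgn]. *)
Lemma wronskian_notin : ~ I (N + N) J.
Proof.
have nN : ((N + N).+1 - n = N)%N by rewrite /n; lia.
move=> [a [b []]]; rewrite nN => sa sb e.
have [] := @pencil_syzygy n f g cfg fgn (a + g^`()) (f^`() - b).
- rewrite (leq_trans (size_polyD _ _)) // geq_max (leqW sa).
  exact: size_deriv_leq size_grad2.
- rewrite (leq_trans (size_polyD _ _)) // geq_max size_polyN (leqW sb) andbT.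
  exact: size_deriv_leq size_grad1.
- by apply/eqP; rewrite -subr_eq0; apply/eqP; rewrite (_ : _ - _ = a * f + b * g - J) /wronskian; [rewrite -e subrr|ring].
move=> /eqP; rewrite addr_eq0 => /eqP ea /eqP; rewrite subr_eq0 => /eqP eb.
have top p : (size p^`() <= N)%N -> p`_n = 0.
  move/leq_sizeP/(_ N (leqnn _)); rewrite coef_deriv => /eqP.
  by rewrite mulrn_eq0 /= => /eqP.
move: fgn; rewrite !top ?eqxx //; last by rewrite eb.
by rewrite -size_polyN -ea.
Qed.

Lemma wronskian_mul_deg : J *+ n = f^`() * (g *+ n - 'X * g^`()) - (f *+ n - 'X * f^`()) * g^`().
Proof. by rewrite /wronskian; ring. Qed.

(** The products defining [J] only bound its degree by 2N+1. As a determinant of second partials,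
    each of degree N, [J *+ n] has degree at most 2N. *)
Lemma size_wronskian : (size J <= (N + N).+1)%N.
Proof.
have -> : size J = size (J *+ n).
  by rewrite -scaler_nat size_scale // pnatr_eq0.
rewrite wronskian_mul_deg (leq_trans (size_polyD _ _)) // size_polyN geq_max.
have szM (u v : {poly K}) : (size u <= n)%N -> (size v <= n)%N -> (size (u * v)%R <= (N + N).+1)%N.
  by move=> su sv; rewrite (leq_trans (size_polyMleq _ _)) //; move: su sv; rewrite /n; lia.
by rewrite !szM // ?(size_euler_leq size_grad1) ?(size_euler_leq size_grad2)
  ?(size_deriv_leq size_grad1) ?(size_deriv_leq size_grad2).
Qed.

(** A dimension count: two cofactors of degree N-1 and one scalar have 2N+1 parameters, as many as a
    form of degree 2N. Injectivity combines [wronskian_notin] with [pencil_syzygy]. *)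
Lemma pencil_span p : (size p <= (N + N).+1)%N ->
  exists c, I (N + N) (p - c *: J).
Proof.
have nN : ((N + N).+1 - n = N)%N by rewrite /n; lia.
pose phi (w : 'rV[K]_(N + N + 1)) :=
  rVpoly (lsubmx (lsubmx w)) * f + rVpoly (rsubmx (lsubmx w)) * g
    + (rsubmx w) 0 0 *: J.
have lphi : linear phi.
  move=> c u v; rewrite /phi !linearD !linearZ /= !mxE.
  by rewrite -!mul_polyC !polyCD !polyCM; ring.
have szM (u v : {poly K}) : (size u <= N)%N -> (size v <= n.+1)%N -> (size (u * v)%R <= N + N + 1)%N.
  by move=> su sv; rewrite (leq_trans (size_polyMleq _ _)) //; move: su sv; rewrite /n; lia.
have sphi v : (size (phi v) <= N + N + 1)%N.
  rewrite (leq_trans (size_polyD _ _)) // geq_max; apply/andP; split; last first.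
    by rewrite (leq_trans (size_scale_leq _ _)) // addn1 size_wronskian.
  rewrite (leq_trans (size_polyD _ _)) // geq_max.
  by rewrite !szM ?size_poly ?size_grad1 ?size_grad2.
suff iphi v : phi v = 0 -> v = 0.
  rewrite -addn1 => sp; have [v <-] := poly_inj_surj lphi sphi iphi sp.
  exists (rsubmx v 0 0); rewrite addrK.
  by exists (rVpoly (lsubmx (lsubmx v))), (rVpoly (rsubmx (lsubmx v))); rewrite nN !size_poly.
move=> e; have vJ : I (N + N) (rsubmx v 0 0 *: J).
  rewrite -[_ *: J]opprK; apply: pencil_idealN.
  exists (rVpoly (lsubmx (lsubmx v))), (rVpoly (rsubmx (lsubmx v))); rewrite nN !size_poly.
  by split=> //; rewrite -[LHS]add0r -e /phi addrK.
have v0 : rsubmx v 0 0 = 0.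
  apply/eqP/negP => /negP v0; apply: wronskian_notin.
  by rewrite -[J]scale1r -(mulVf v0) -scalerA; exact: pencil_idealZ.
have [] := @pencil_syzygy n f g cfg fgn (rVpoly (lsubmx (lsubmx v))) (- rVpoly (rsubmx (lsubmx v))).
- by rewrite leqW ?size_poly.
- by rewrite size_polyN leqW ?size_poly.
- by apply/eqP; rewrite -subr_eq0 mulNr opprK -e /phi v0 scale0r addr0.
have rV0 (u : 'rV[K]_N) : rVpoly u = 0 -> u = 0.
  by move=> u0; rewrite -[u]rVpolyK u0 linear0.
move=> /rV0 vl /eqP; rewrite oppr_eq0 => /eqP/rV0 vr.
rewrite -[v]hsubmxK -[lsubmx v]hsubmxK vl vr row_mx0.
suff -> : rsubmx v = 0 by rewrite row_mx0.
by apply/rowP => i; rewrite ord1 v0 mxE.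
Qed.

(** In degree 2N+1 the complement spanned by [J] is absorbed, since both variables multiply [J] into
    the ideal. Above, a form is a scalar times a power of z_2 plus z_1 times a form of lower
    degree. *)
Lemma pencil_top d p : (N + N < d)%N -> (size p <= d.+1)%N -> I d p.
Proof.
have base p' : (size p' <= (N + N).+1)%N -> I (N + N).+1 p' /\ I (N + N).+1 ('X * p').
  move=> /pencil_span[c cJ]; rewrite -[p'](subrK (c *: J)); split.
    apply: pencil_idealD; first exact: pencil_ideal_succ.
    exact/pencil_idealZ/wronskian_succ.
  rewrite mulrDr -scalerAr; apply: pencil_idealD; first exact: pencil_ideal_mulX.
  exact/pencil_idealZ/wronskian_mulX.
elim: d p => // d IH p; rewrite ltnS leq_eqVlt => /orP[/eqP <-|dN] sp;
    have [c [p' [sp' ->]]] := poly_behead sp.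
  apply: pencil_idealD; last by case: (base _ sp').
  by case: (base c%:P); rewrite // (leq_trans (size_polyC_leq1 _)).
apply: pencil_idealD; last by apply: pencil_ideal_mulX; exact: IH.
by apply: pencil_ideal_succ; apply: IH; rewrite // (leq_trans (size_polyC_leq1 _)).
Qed.

(** * Gorenstein duality and a second power in the pencil *)

Section Functional.
Variable T : {poly K} -> K.
Hypothesis T0 : forall p, (size p <= (N + N).+1)%N -> T p = 0 <-> I (N + N) p.

(** Induction on the complementary degree [e]: z_1 p and z_2 p satisfy the hypothesis with [e]
    lowered by one, and [pencil_ideal_descent] leads back to [p]. For [e = 0] the test [h = 1]
    suffices. *)
Lemma pencil_duality d e p : (d + e = N + N)%N -> (size p <= d.+1)%N ->
  (forall h, (size h <= e.+1)%N -> T (p * h) = 0) -> I d p.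
Proof.
elim: e d p => [|e IH] d p.
  rewrite addn0 => -> sp /(_ 1); rewrite mulr1 size_poly1 => /(_ isT).
  exact: (T0 sp).1.
move=> de sp Tp; apply: (pencil_ideal_descent cfg fgn).
- by rewrite /n; lia.
- apply: IH => [||h sh]; [lia|exact: leqW|].
  by apply: Tp; exact: leqW.
- apply: IH => [||h sh]; [lia|exact: size_mulX_leq|].
  by rewrite -mulrA mulrCA; apply: Tp; exact: size_mulX_leq.
Qed.

(** By duality l^n is the derivative of the form [q] along some direction (al, be). The direction
    (s, -r) annihilates l, so the derivative [G] of [q] along (s, -r) is constant along (al, be),
    hence a multiple of the n-th power of be z_1 - al z_2. *)
Lemma pencil_second_root r s : (r != 0) || (s != 0) ->
  (forall h, (size h <= N)%N -> T ((s%:P + r *: 'X) ^+ n * h) = 0) ->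
  exists r' s', r * s' - r' * s != 0 /\
    forall h, (size h <= N)%N -> T ((s'%:P + r' *: 'X) ^+ n * h) = 0.
Proof.
move=> rs Tl; set l := s%:P + r *: 'X.
have sl := size_linear_leq s r.
have [a [b [sa sb el]]] : I n (l ^+ n).
  apply: (@pencil_duality n N.-1); rewrite ?size_linear_exp_leq //; first by rewrite /n; lia.
  by move=> h; rewrite prednK //; exact: Tl.
move: sa sb; rewrite subSnn => /size1_polyC ea /size1_polyC eb.
move: el; rewrite ea eb; move: (a`_0) (b`_0) => al be el {ea eb a b}.
have derl : l^`() = r%:P.
  by rewrite /l derivD derivC derivZ derivX add0r alg_polyC.
have ldef : l = s%:P + r%:P * 'X by rewrite /l mul_polyC.
clearbody l.
have L : (al%:P - be%:P * 'X) * f + q *+ n.+1 * be%:P = l ^+ n.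
  by rewrite el /g /f; ring.
have L' : (al%:P - be%:P * 'X) * f^`() + f *+ n * be%:P = l ^+ N * r%:P *+ n.
  have := congr1 (@deriv K) L.
  rewrite derivD !derivM derivB derivM !derivC derivX derivMn deriv_exp derl -/f /= => e.
  by rewrite [l ^+ N * _]mulrC -e; ring.
(* This scalar is the value of [l] at (al, be); if it is non-zero, the new linear form is
   independent of [l]. *)
have [ars|ars] := eqVneq (al * r + be * s) 0; last first.
  pose G := s%:P * f - r%:P * g.
  have odeG : (al%:P - be *: 'X) * G^`() + (be *: G) *+ n = 0.
    have -> : (al%:P - be *: 'X) * G^`() + (be *: G) *+ n =
       l * (l ^+ N * r%:P *+ n) - (l ^+ n * r%:P) *+ n.
      rewrite -L' -L /G /g -!mul_polyC derivB !derivM derivB derivMn derivM !derivC derivX -/f ldef.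
      ring.
    by rewrite /n exprS; ring.
  have ab0 : (al != 0) || (be != 0).
    by rewrite -negb_and; apply: contra ars => /andP[/eqP-> /eqP->]; rewrite !mul0r addr0.
  have [e Ge] := euler_ode_sol ab0 odeG.
  exists be, (- al); split; first by rewrite mulrN -opprD oppr_eq0 mulrC.
  have e0 : e != 0.
    apply: contra ars => /eqP e0; move/eqP: Ge; rewrite e0 scale0r subr_eq0 => /eqP/(pencil_syzygy cfg fgn).
    case=> [||/eqP]; rewrite ?(leq_trans (size_polyC_leq1 _)) //.
    by rewrite polyC_eq0 => /eqP -> /eqP; rewrite polyC_eq0 => /eqP ->; rewrite !mulr0 addr0.
  have IW : I n ((be *: 'X - al%:P) ^+ n).
    rewrite -[_ ^+ _]scale1r -(mulVf e0) -scalerA -Ge; apply: pencil_idealZ.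
    exists s%:P, (- r%:P); rewrite subSnn size_polyN !size_polyC_leq1 /G.
    by split=> //; ring.
  move=> h sh; rewrite polyCN addrC; apply/T0.
    rewrite addrC -polyCN.
    exact: size_mulS_leq (size_linear_exp_leq n (size_linear_leq _ _)) sh.
  have -> : (N + N = n + N.-1)%N by rewrite /n; lia.
  by apply: pencil_idealM; rewrite // prednK.
(* Now (al, be) is the zero of [l], and this point becomes a common zero of the partials: at
   infinity if [r = 0], against [fgn], and otherwise at [- s / r], against [cfg]. *)
exfalso; have [r0|r0] := eqVneq r 0.
  move: rs ars; rewrite r0 eqxx /= mulr0 add0r => s0 /eqP.
  rewrite mulf_eq0 (negbTE s0) orbF => /eqP be0.
  have al0 : al != 0.
    apply/eqP => al0; move: L; rewrite al0 be0 ldef r0 => /eqP.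
    by rewrite !(polyC0, mul0r, mulr0, oppr0, addr0, subr0, add0r) eq_sym expf_eq0 /= polyC_eq0 (negbTE s0).
  have qn k : q`_k.+2 = 0.
    move: (congr1 (fun p : {poly K} => p`_k.+1) L).
    rewrite be0 ldef r0 !(polyC0, mul0r, addr0, mulr0, oppr0, addr0, subr0, addr0) -rmorphXn.
    rewrite coefCM coefC coef_deriv /= => /eqP.
    by rewrite mulf_eq0 (negbTE al0) mulrn_eq0 => /eqP.
  move: fgn; rewrite /g /f /n coefB coefMn coefXM !coef_deriv.
  case: (N) N1 => // k _ /=.
  by rewrite !qn !mul0rn subrr eqxx.
have be0 : be != 0.
  apply/eqP => be0; move: ars; rewrite be0 mul0r addr0 => /eqP.
  rewrite mulf_eq0 (negbTE r0) orbF => /eqP al0.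
  move/eqP: L; rewrite al0 be0 !(polyC0, mul0r, mulr0, oppr0, addr0, subr0, add0r) eq_sym expf_eq0 /=.
  move=> /eqP l0; have := congr1 (fun p : {poly K} => p`_1) l0.
  by rewrite ldef coefD coefC coefCM coefX coef0 /= add0r mulr1; apply/eqP.
pose t := - s / r.
have lt : l.[t] = 0 by rewrite ldef !(hornerD, hornerM, hornerC, hornerX) /t; field.
have abt : al - be * t = 0.
  by rewrite /t; apply: (mulIf r0); rewrite mul0r -ars; field.
have qt : q.[t] = 0.
  move: (congr1 (fun p : {poly K} => p.[t]) L); rewrite !(hornerMn, horner_exp, hornerM, hornerC, hornerX, hornerN, hornerD) abt lt.
  rewrite mul0r add0r expr0n /= => /eqP.
  by rewrite mulf_eq0 (negbTE be0) orbF mulrn_eq0 => /eqP.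
have ft : f.[t] = 0.
  move: (congr1 (fun p : {poly K} => p.[t]) L').
  rewrite !(hornerMn, horner_exp, hornerM, hornerC, hornerX, hornerN, hornerD) abt lt.
  rewrite mul0r add0r expr0n eqn0Ngt N1 /= mul0r mul0rn => /eqP.
  by rewrite mulf_eq0 (negbTE be0) orbF mulrn_eq0 => /eqP.
have /eqP := coprimep_root cfg (introT eqP ft : root f t); apply.
by rewrite /g hornerD hornerN hornerM hornerMn -/f qt ft mulr0 mul0rn subr0.
Qed.

End Functional.
End Gradient.
End BinaryPencil.

(** * The apolar pairing and catalecticants *)

Section BinaryFormPolar.
Variable K : numClosedFieldType.
Implicit Types (a b : nat -> K) (g h : {poly K}) (z v w : 'rV[K]_2) (M : 'M[K]_2).

(* [apolar d a] pairs the form with coefficients [a] with a dehomogenized form [h] of degree [d], where ['X^i] stands for [z_1^i z_2^(d-i)]. *)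
Definition apolar d a h : K := \sum_(k < d.+1) a k * h`_(d - k).

Definition linpoly z : {poly K} := (z 0 1)%:P + z 0 0 *: 'X.

Lemma apolar_is_linear d a : linear_for *%R (apolar d a).
Proof.
move=> c u v; rewrite /apolar mulr_sumr -big_split /=.
by apply: eq_bigr => k _; rewrite coefD coefZ; ring.
Qed.
HB.instance Definition _ d a := GRing.isLinear.Build K {poly K} K *%R (apolar d a) (apolar_is_linear d a).

Lemma apolarX d a k : (k <= d)%N -> apolar d a 'X^(d - k) = a k.
Proof.
move=> kd; rewrite /apolar (bigD1 (inord k)) //= inordK ?ltnS //.
rewrite coefXn eqxx mulr1 big1 ?addr0 // => i ik.
rewrite coefXn; case: eqP => [e|_]; last by rewrite mulr0.
by case/eqP: ik; apply/val_inj; rewrite /= inordK //; have := ltn_ord i; lia.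
Qed.

Lemma apolar_exp_lin d a z :
  apolar d a (linpoly z ^+ d) = \sum_(j < d.+1) a j * z 0 0 ^+ (d - j) * z 0 1 ^+ j *+ 'C(d, j).
Proof.
rewrite /linpoly addrC exprDn linear_sum; apply: eq_bigr => j _.
rewrite raddfMn /= exprZn -rmorphXn /= mulrC mul_polyC scalerA linearZ /=.
by rewrite apolarX 1?mulrC 1?[_ * _ ^+ (_ - _)]mulrC ?mulrA // -ltnS.
Qed.

Lemma size_linpoly z : (size (linpoly z) <= 2)%N.
Proof. exact: size_linear_leq. Qed.

Lemma linpolyD z v : linpoly (z + v) = linpoly z + linpoly v.
Proof. by rewrite /linpoly !mxE polyCD scalerDl addrACA. Qed.
Lemma linpolyZ c z : linpoly (c *: z) = c *: linpoly z.
Proof. by rewrite /linpoly !mxE polyCM scalerDr scalerA mul_polyC. Qed.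

Lemma linpoly_mulmx z M :
  linpoly (z *m M) = z 0 0 *: linpoly (row 0 M) + z 0 1 *: linpoly (row 1 M).
Proof.
rewrite -!linpolyZ -linpolyD; congr linpoly; apply/rowP => j.
have e1 : lift ord0 ord0 = 1 :> 'I_2 by apply/val_inj.
by rewrite !mxE big_ord_recl big_ord1 e1.
Qed.

(** The coefficients, linear in [a], of the form composed with the substitution of [z *m M] for [z];
    see [apolar_twist]. *)
Definition twist d a M j : K := apolar d a (linpoly (row 0 M) ^+ (d - j) * linpoly (row 1 M) ^+ j).

Lemma apolar_twist d a M z :
  apolar d (twist d a M) (linpoly z ^+ d) = apolar d a (linpoly (z *m M) ^+ d).
Proof.
rewrite apolar_exp_lin linpoly_mulmx exprDn linear_sum; apply: eq_bigr => j _.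
rewrite raddfMn /= !exprZn -scalerAl -scalerAr scalerA linearZ /= /twist; congr (_ *+ _); ring.
Qed.

Lemma poly_ext (p q : {poly K}) : (forall x, p.[x] = q.[x]) -> p = q.
Proof.
move=> e; apply/eqP; rewrite -subr_eq0; apply/negP => /negP nz.
pose s := [seq (i%:R : K) | i <- iota 0 (size (p - q))].
have us : uniq s by rewrite map_inj_uniq ?iota_uniq // => i j /eqP; rewrite eqr_nat => /eqP.
have ar : all (root (p - q)) s.
  by apply/allP => x _; rewrite rootE hornerD hornerN e subrr.
by have := max_poly_roots nz ar us; rewrite size_map size_iota ltnn.
Qed.

Lemma apolar_ext d a b :
  (forall z, apolar d a (linpoly z ^+ d) = apolar d b (linpoly z ^+ d)) ->
  forall k, (k <= d)%N -> a k = b k.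
Proof.
move=> e k kd.
have E : \poly_(j < d.+1) (a j *+ 'C(d, j)) = \poly_(j < d.+1) (b j *+ 'C(d, j)).
  apply: poly_ext => y; rewrite !horner_poly.
  have := e (\row_i (if i == 0 then 1 else y)); rewrite !apolar_exp_lin !mxE /=.
  move=> h; apply: etrans (etrans h _); apply: eq_bigr => j _; rewrite expr1n; ring.
have := congr1 (fun p : {poly K} => p`_k) E; rewrite !coef_poly ltnS kd => /eqP.
by rewrite eqrMn2r -leqn0 leqNgt bin_gt0 kd => /eqP.
Qed.

Lemma apolar_eq d a b : (forall k, (k <= d)%N -> a k = b k) -> apolar d a =1 apolar d b.
Proof. by move=> e h; apply: eq_bigr => k _; rewrite e // -ltnS. Qed.

(** These values, times binomial coefficients, are the coefficients of the expansion in [y], and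
    divisibility by y^m kills those below [m]. *)
Lemma apolar_root d a v w m (r : {poly K}) : (m <= d.+1)%N ->
  (forall y, apolar d a (linpoly (v + y *: w) ^+ d) = y ^+ m * r.[y]) ->
  forall j, (j < m)%N -> apolar d a (linpoly v ^+ (d - j) * linpoly w ^+ j) = 0.
Proof.
move=> md e j jm.
have E : \poly_(j < d.+1) (apolar d a (linpoly v ^+ (d - j) * linpoly w ^+ j) *+ 'C(d, j)) = 'X^m * r.
  apply: poly_ext => y; rewrite horner_poly hornerM hornerXn -e linpolyD linpolyZ exprDn.
  rewrite linear_sum; apply: eq_bigr => i _.
  rewrite raddfMn /= exprZn -scalerAr linearZ /=; ring.
have := congr1 (fun p : {poly K} => p`_j) E.
rewrite coefXnM jm coef_poly (leq_trans jm md) => /eqP.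
by rewrite mulrn_eq0 -leqn0 leqNgt bin_gt0 -ltnS (leq_trans jm md) => /eqP.
Qed.

Lemma binary_span M N h : M \in unitmx -> (size h <= N.+1)%N ->
  exists c : nat -> K,
    h = \sum_(j < N.+1) c j *: (linpoly (row 0 M) ^+ (N - j) * linpoly (row 1 M) ^+ j).
Proof.
move=> uM; set l0 := linpoly _; set l1 := linpoly _.
pose W N h := exists c : nat -> K, h = \sum_(j < N.+1) c j *: (l0 ^+ (N - j) * l1 ^+ j).
have WD n p q : W n p -> W n q -> W n (p + q).
  move=> [c ->] [c' ->]; exists (fun j => c j + c' j).
  by rewrite -big_split; apply: eq_bigr => j _; rewrite scalerDl.
have WZ n x p : W n p -> W n (x *: p).
  move=> [c ->]; exists (fun j => x * c j).
  by rewrite scaler_sumr; apply: eq_bigr => j _; rewrite scalerA.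
have W0 n p : W n p -> W n.+1 (l0 * p).
  move=> [c ->]; exists (fun j => if (j <= n)%N then c j else 0).
  rewrite [RHS]big_ord_recr /= ltnn scale0r addr0 mulr_sumr; apply: eq_bigr => j _.
  by rewrite -ltnS ltn_ord -scalerAr mulrA -exprS subSn // -ltnS.
have W1 n p : W n p -> W n.+1 (l1 * p).
  move=> [c ->]; exists (fun j => if j is j'.+1 then c j' else 0).
  rewrite [RHS]big_ord_recl /= scale0r add0r mulr_sumr; apply: eq_bigr => j _.
  by rewrite -scalerAr mulrCA -exprS.
have lin z : exists x y, linpoly z = x *: l0 + y *: l1.
  by exists ((z *m invmx M) 0 0), ((z *m invmx M) 0 1); rewrite -linpoly_mulmx mulmxKV.
have WL n z p : W n p -> W n.+1 (linpoly z * p).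
  by have [x [y ->]] := lin z => Wp; rewrite mulrDl -!scalerAl; apply: WD; apply: WZ; auto.
have linX : linpoly (delta_mx 0 0) = 'X by rewrite /linpoly !mxE /= polyC0 add0r scale1r.
have lin1 : linpoly (delta_mx 0 1) = 1 by rewrite /linpoly !mxE /= scale0r addr0.
rewrite -/(W N h); elim: N h => [|N IH] h sh.
  exists (fun=> h`_0); rewrite big_ord1 !expr0 mulr1 alg_polyC; exact: size1_polyC.
have [c [p [sp ->]]] := poly_behead sh.
apply: WD; last by rewrite -linX; apply: WL; exact: IH.
rewrite -[c%:P]mul1r -lin1; apply: WL; apply: IH.
by rewrite (leq_trans (size_polyC_leq1 _)).
Qed.

Lemma apolar_mul0 e d a M : M \in unitmx ->
  (forall j, (j < d.+1)%N ->
     apolar (e + d) a (linpoly (row 0 M) ^+ (e + d - j) * linpoly (row 1 M) ^+ j) = 0) ->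
  forall h, (size h <= d.+1)%N -> apolar (e + d) a (linpoly (row 0 M) ^+ e * h) = 0.
Proof.
move=> uM H h /(binary_span uM)[c ->]; rewrite mulr_sumr linear_sum big1 // => j _.
rewrite -scalerAr linearZ /= mulrA -exprD addnBA; last by rewrite -ltnS.
by rewrite H ?mulr0.
Qed.

Definition hankel N a : 'M[K]_N.+1 := \matrix_(i, j) a (i + j)%N.

Lemma poly_rev_expand d h : (size h <= d.+1)%N ->
  h = \sum_(i < d.+1) h`_(d - i) *: 'X^(d - i).
Proof.
move=> sh; rewrite (reindex_inj rev_ord_inj) /=.
rewrite [LHS](_ : h = \poly_(i < d.+1) h`_i).
  by rewrite poly_def; apply: eq_bigr => i _; rewrite subSS subKn // -ltnS.
by apply/polyP => k; rewrite coef_poly; case: ltnP => // /(leq_trans sh)/(nth_default _) ->.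
Qed.

(** So [hankel N a] is the Gram matrix of the apolar pairing on forms of degree N, in the monomial
    basis ordered by decreasing powers. *)
Lemma apolar_mul N a g h : (size g <= N.+1)%N -> (size h <= N.+1)%N ->
  apolar (N + N) a (g * h) = \sum_(i < N.+1) \sum_(j < N.+1) g`_(N - i) * a (i + j)%N * h`_(N - j).
Proof.
move=> /poly_rev_expand eg /poly_rev_expand eh; rewrite {1}eg {1}eh mulr_suml linear_sum; apply: eq_bigr => i _.
rewrite mulr_sumr linear_sum; apply: eq_bigr => j _.
rewrite -scalerAr -scalerAl scalerA linearZ /= -exprD.
have -> : (N - i + (N - j) = N + N - (i + j))%N by have := ltn_ord i; have := ltn_ord j; lia.
by rewrite apolarX; [ring | have := ltn_ord i; have := ltn_ord j; lia].
Qed.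

Lemma hankel_nondegenerate N a g : hankel N a \in unitmx -> (size g <= N.+1)%N ->
  (forall h, (size h <= N.+1)%N -> apolar (N + N) a (g * h) = 0) -> g = 0.
Proof.
move=> uH sg H; pose v : 'rV[K]_N.+1 := \row_i g`_(N - i).
have v0 : v *m hankel N a = 0.
  apply/rowP => j; rewrite !mxE -[RHS](H 'X^(N - j)) ?size_polyXn ?ltnS ?leq_subr //.
  rewrite apolar_mul ?size_polyXn ?ltnS ?leq_subr //; apply: eq_bigr => i _.
  rewrite (bigD1 j) //= big1 ?addr0 ?coefXn ?eqxx ?mulr1 ?mxE // => k kj.
  rewrite coefXn; case: eqP => [e|_]; last by rewrite mulr0.
  by case/eqP: kj; apply/val_inj; have := ltn_ord j; have := ltn_ord k; rewrite /=; lia.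
have : v = 0 by rewrite -[v](mulmxK uH) v0 mul0mx.
move/rowP => e; apply/polyP => k; rewrite coef0; have [kN|kN] := ltnP k N.+1; last first.
  by rewrite nth_default // (leq_trans sg).
have := e (inord (N - k)); rewrite !mxE inordK ?ltnS ?leq_subr //.
by rewrite subKn.
Qed.

Lemma hankel_unit N a :
  (forall g, (size g <= N.+1)%N ->
    (forall h, (size h <= N.+1)%N -> apolar (N + N) a (g * h) = 0) -> g = 0) ->
  \det (hankel N a) != 0.
Proof.
move=> H; apply/negP => /det0P[v v0 vH]; case/eqP: v0.
pose g := \poly_(i < N.+1) v 0 (inord (N - i)).
have gE (i : 'I_N.+1) : g`_(N - i) = v 0 i.
  by rewrite coef_poly ltnS leq_subr subKn ?inord_val // -ltnS ltn_ord.
suff g0 : g = 0 by apply/matrixP => i0 i; rewrite ord1 mxE -gE g0 coef0.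
apply: H => [|h sh]; first exact: size_poly.
rewrite apolar_mul ?size_poly // exchange_big big1 //= => j _.
rewrite -mulr_suml; move/rowP/(_ j): vH; rewrite !mxE => vH.
rewrite [X in X * _](_ : _ = 0) ?mul0r // -[RHS]vH; apply: eq_bigr => i _.
by rewrite gE mxE.
Qed.

(** A substitution changes the Gram matrix by congruence with its matrix [B] on forms of degree
    N. *)
Lemma det_hankel_twist N M : exists x, forall a,
  \det (hankel N (twist (N + N) a M)) = x * \det (hankel N a).
Proof.
set l0 := linpoly (row 0 M); set l1 := linpoly (row 1 M).
pose B : 'M[K]_N.+1 := \matrix_(i, k) (l0 ^+ (N - i) * l1 ^+ i)`_(N - k).
exists (\det B * \det B) => a.
suff -> : hankel N (twist (N + N) a M) = B *m hankel N a *m B^T.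
  by rewrite !det_mulmx det_tr mulrAC.
have sz (i : 'I_N.+1) : (size (l0 ^+ (N - i) * l1 ^+ i)%R <= N.+1)%N.
  have := size_mulS_leq (size_linear_exp_leq (N - i) (size_linpoly (row 0 M)))
    (size_linear_exp_leq i (size_linpoly (row 1 M))).
  by rewrite addnS subnK // -ltnS.
apply/matrixP => i j; rewrite !mxE /twist.
have -> : l0 ^+ (N + N - (i + j)) * l1 ^+ (i + j) =
    (l0 ^+ (N - i) * l1 ^+ i) * (l0 ^+ (N - j) * l1 ^+ j).
  have -> : (N + N - (i + j) = N - i + (N - j))%N by have := ltn_ord i; have := ltn_ord j; lia.
  by rewrite !exprD; ring.
rewrite apolar_mul // exchange_big /=; apply: eq_bigr => k' _.
rewrite !mxE mulr_suml; apply: eq_bigr => k _.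
by rewrite !mxE.
Qed.

(** The inverse substitution recovers [hankel N a], so the factor in [det_hankel_twist] never has to
    be computed. *)
Lemma hankel_twist_unit N a M : M \in unitmx ->
  \det (hankel N a) != 0 -> \det (hankel N (twist (N + N) a M)) != 0.
Proof.
move=> uM; have [x xE] := det_hankel_twist N (invmx M).
suff -> : hankel N a = hankel N (twist (N + N) (twist (N + N) a M) (invmx M)).
  by rewrite xE; apply: contra => /eqP ->; rewrite mulr0.
apply/matrixP => i j; rewrite !mxE.
apply: (@apolar_ext (N + N)) => [z|]; last by have := ltn_ord i; have := ltn_ord j; lia.
by rewrite !apolar_twist mulmxKV.
Qed.

End BinaryFormPolar.

(** * Symmetric conditions on the roots *)

Section RootConditions.
Variable K : numClosedFieldType.
Implicit Types (a b : nat -> K).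

Definition dehom d a : {poly K} := \sum_(j < d.+1) (a j *+ 'C(d, j)) *: 'X^(d - j).

Lemma horner_dehom d a x (z : 'rV[K]_2) : z 0 0 = x -> z 0 1 = 1 -> (dehom d a).[x] = apolar d a (linpoly z ^+ d).
Proof.
move=> z0 z1; rewrite apolar_exp_lin z0 z1 /dehom horner_sum; apply: eq_bigr => j _.
by rewrite hornerZ hornerXn expr1n; ring.
Qed.

Lemma coef_dehom d a j : (j <= d)%N -> (dehom d a)`_(d - j) = a j *+ 'C(d, j).
Proof.
move=> jd; rewrite /dehom coef_sum (bigD1 (inord j)) //= inordK ?ltnS //.
rewrite coefZ coefXn eqxx mulr1 big1 ?addr0 // => i ij.
rewrite coefZ coefXn; case: eqP => [e|_]; last by rewrite mulr0.
by case/eqP: ij; apply/val_inj; rewrite /= inordK //; have := ltn_ord i; lia.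
Qed.

(** When [a 0] is non-zero, (1, 0) is not a root of the form and the tuple lists all its roots. *)
Definition splits d a (r : d.-tuple K) := dehom d a = a 0%N *: \prod_(c <- r) ('X - c%:P).

Lemma splits_exists d a : a 0%N != 0 -> exists r : d.-tuple K, splits a r.
Proof.
move=> a0; have [r e] := closed_field_poly_normal (dehom d a).
have sd : (size (dehom d a) <= d.+1)%N.
  apply: (leq_trans (size_sum _ _ _)); apply/bigmax_leqP => j _.
  by rewrite (leq_trans (size_scale_leq _ _)) // size_polyXn ltnS leq_subr.
have cd : (dehom d a)`_d = a 0%N by have := coef_dehom a (leq0n d); rewrite subn0 bin0 mulr1n.
have sE : size (dehom d a) = d.+1.
  apply/eqP; rewrite eqn_leq sd /= ltnNge; apply: contra a0 => /leq_sizeP/(_ d (leqnn _)).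
  by rewrite cd => ->.
have lE : lead_coef (dehom d a) = a 0%N by rewrite lead_coefE sE.
have sr : size r == d.
  by move: sE; rewrite e lE size_scale // size_prod_XsubC => -[->].
by exists (Tuple sr); rewrite /splits e lE.
Qed.

Lemma meval_msym n (s : 'S_n) (p : {mpoly K[n]}) v :
  (msym s p).@[v] = p.@[fun i => v (s i)].
Proof.
have := congr1 (meval v) (msym_mPo s p [tuple 'X_i | i < n]).
rewrite !comp_mpoly_meval => e; apply: etrans (etrans e _); apply: meval_eq => i.
  by rewrite tnth_mktuple mevalXU.
by rewrite !tnth_mktuple mevalXU.
Qed.

(* A symmetric function of the roots is a polynomial in the coefficients divided by a power of the leading one. *)
Lemma symmetric_root_condition d (E : {mpoly K[d]}) :
  exists f : {mpoly K[d.+1]}, forall a,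
    (a 0%N = 0 -> f.@[fun j => a j] = 0) /\
    forall r : d.-tuple K, a 0%N != 0 -> splits a r ->
      (f.@[fun j => a j] == 0) = [exists s : 'S_d, E.@[fun i => tnth r (s i)] == 0].
Proof.
(* Symmetric, and zero at a tuple exactly when [E] vanishes at one of its orderings. *)
pose P := \prod_(s : 'S_d) msym s E.
have symP : P \is symmetric.
  apply/issymP => t; rewrite /P rmorph_prod /= [RHS](reindex_inj (mulIg t)) /=.
  by apply: eq_bigr => s _; rewrite msymMm.
have [G [GP _]] := sym_fundamental symP.
pose D := msize G.
(* By Vieta, [X i] evaluates to [a 0] times the elementary symmetric function of degree [i.+1] of
   the roots. *)
pose X (i : 'I_d) : {mpoly K[d.+1]} := ((-1) ^+ i.+1 *+ 'C(d, i.+1)) *: 'X_(lift ord0 i).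
(* Homogenizing [G] by the leading coefficient clears denominators. [D] exceeds all degrees in [G],
   so the exponent is positive and [f] vanishes where [a 0 = 0]. *)
pose f := \sum_(m <- msupp G) G@_m *: (\prod_(i < d) X i ^+ m i * 'X_ord0 ^+ (D.+1 - mdeg m)).
have fE a : f.@[fun j => a j] =
    \sum_(m <- msupp G) G@_m * (\prod_(i < d) ((-1) ^+ i.+1 * (a i.+1 *+ 'C(d, i.+1))) ^+ m i * a 0%N ^+ (D.+1 - mdeg m)).
  rewrite /f raddf_sum; apply: eq_bigr => m _ /=.
  rewrite mevalZ mevalM rmorph_prod rmorphXn /= mevalXU; congr (_ * (_ * _)).
  apply: eq_bigr => i _; rewrite rmorphXn /= mevalZ mevalXU; congr (_ ^+ _).
  by rewrite /= /bump /= add1n; ring.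
have mD m : m \in msupp G -> (mdeg m < D)%N by exact: msize_mdeg_lt.
exists f => a; split=> [a0|r a0 sp].
  rewrite fE big_seq big1 // => m /mD mlt; rewrite a0 expr0n.
  by rewrite (_ : D.+1 - mdeg m == 0 = false)%N ?mulr0 //; lia.
have cE i : (i < d)%N -> (-1) ^+ i.+1 * (a i.+1 *+ 'C(d, i.+1)) = a 0%N * (mesym d K i.+1).@[tnth r].
  move=> id; rewrite -coef_dehom // sp coefZ.
  have := mroots_coeff r (Ordinal (id : i.+1 < d.+1)%N) => /= ->.
  by rewrite mulrCA signrMK.
have -> : f.@[fun j => a j] = a 0%N ^+ D.+1 * P.@[tnth r].
  rewrite fE -GP comp_mpoly_meval mevalE mulr_sumr big_seq [RHS]big_seq.
  apply: eq_bigr => m /mD mlt; rewrite [RHS]mulrCA; congr (_ * _).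
  rewrite (eq_bigr (fun i : 'I_d => a 0%N ^+ m i * (mesym d K i.+1).@[tnth r] ^+ m i)); last first.
    by move=> i _; rewrite cE // exprMn.
  rewrite big_split /= prodrXr -mdegE mulrAC -exprD subnKC; last by lia.
  by congr (_ * _); apply: eq_bigr => i _; rewrite tnth_mktuple.
rewrite mulf_eq0 expf_eq0 (negbTE a0) /= /P rmorph_prod /= prodf_seq_eq0.
apply/hasP/existsP => [[s _ /=]|[s e]].
  by rewrite meval_msym => e; exists s.
by exists s; rewrite ?mem_index_enum //= meval_msym.
Qed.

(** One combination of the conditions, weighted by powers of a suitable scalar [u], is non-zero at
    every ordering of [r]; [symmetric_root_condition] turns it into a condition on coefficients. *)
Lemma root_condition_separates d (I : finType) (E : I -> {mpoly K[d]}) (O : (nat -> K) -> Prop) b (r : d.-tuple K) :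
  (forall a, O a -> a 0%N != 0 ->
     exists2 r' : d.-tuple K, splits a r' & forall i, (E i).@[tnth r'] = 0) ->
  b 0%N != 0 -> splits b r ->
  (forall s : 'S_d, exists i, (E i).@[fun j => tnth r (s j)] != 0) ->
  exists f : {mpoly K[d.+1]}, f.@[fun j => b j] != 0 /\ forall a, O a -> f.@[fun j => a j] = 0.
Proof.
move=> OE b0 sb nb.
pose p (s : 'S_d) : {poly K} := \sum_i (E i).@[fun j => tnth r (s j)] *: 'X^(enum_rank i).
have p0 s : p s != 0.
  have [i ei] := nb s; apply: contra ei => /eqP ps.
  have := congr1 (fun q : {poly K} => q`_(enum_rank i)) ps; rewrite coef0 coef_sum (bigD1 i) //=.
  rewrite coefZ coefXn eqxx mulr1 big1 ?addr0 => [->//|k ki].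
  rewrite coefZ coefXn; case: eqP => [/val_inj/enum_rank_inj e|_]; last by rewrite mulr0.
  by rewrite e eqxx in ki.
(* Each ordering violates some condition, so each [p s] is a non-zero polynomial in [u], and a
   non-root of the product serves all orderings. *)
have [u pu] : exists u, (\prod_s p s).[u] != 0.
  apply: contrapT => H; have : \prod_s p s != 0 by apply/prodf_neq0 => s _.
  case/eqP; apply: poly_ext => x; rewrite horner0; apply/eqP/negP => /negP nx.
  by apply: H; exists x.
pose F := \sum_i u ^+ enum_rank i *: E i.
have FE v : F.@[v] = \sum_i u ^+ enum_rank i * (E i).@[v].
  by rewrite /F raddf_sum; apply: eq_bigr => i _; rewrite /= mevalZ.
have [f fP] := symmetric_root_condition F; exists f; split.
  rewrite ((fP b).2 r b0 sb); apply/existsP => -[s]; rewrite FE => e.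
  move: pu; rewrite horner_prod => /prodf_neq0/(_ s isT); rewrite /p horner_sum.
  case/negP; apply/eqP; rewrite -[RHS](eqP e); apply: eq_bigr => i _.
  by rewrite hornerZ hornerXn mulrC.
move=> a Oa; have [/(fP a).1 //|a0] := eqVneq (a 0%N) 0.
have [r' sr' Er'] := OE a Oa a0; apply/eqP; rewrite ((fP a).2 r' a0 sr').
apply/existsP; exists 1%g; rewrite FE big1 // => i _.
by rewrite (meval_eq (v2 := tnth r')) ?Er' ?mulr0 // => j; rewrite perm1.
Qed.

End RootConditions.

(** * Moebius equivalence of root configurations *)

Section Moebius.
Variable K : numClosedFieldType.

Lemma det_mx2 (R : comNzRingType) (M : 'M[R]_2) : \det M = M 0 0 * M 1 1 - M 0 1 * M 1 0.
Proof.
have l1 : lift ord0 ord0 = 1 :> 'I_2 by apply/val_inj.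
have l0 : lift 1 ord0 = 0 :> 'I_2 by apply/val_inj.
rewrite (expand_det_row _ ord0) big_ord_recl big_ord1 /cofactor !det_mx11 !mxE l1 l0 /=.
by rewrite addn0 addn1 expr0 expr1; ring.
Qed.

Lemma unitmx2 (M : 'M[K]_2) : (M \in unitmx) = (M 0 0 * M 1 1 - M 0 1 * M 1 0 != 0).
Proof. by rewrite unitmxE unitfE det_mx2. Qed.

Definition mx22 (a b c d : K) : 'M[K]_2 :=
  \matrix_(i, j) if i == 0 then (if j == 0 then a else b) else (if j == 0 then c else d).

(** Equality of two cross-ratios, cleared of denominators so that points may coincide. *)
Definition cross_eq (l1 l2 l3 l4 r1 r2 r3 r4 : K) :=
  (l1 - l2) * (l3 - l4) * ((r1 - r3) * (r2 - r4)) - (l1 - l3) * (l2 - l4) * ((r1 - r2) * (r3 - r4)).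

(** For invertible [M]: the row (l, 1) times [M] is proportional to (r, 1), so a root [r] of a form
    yields the root [l] of the form composed with [M]. *)
Definition moebius_rel (M : 'M[K]_2) l r := l * (M 0 0 - r * M 0 1) = r * M 1 1 - M 1 0.

(* The entries of the matrix are the 3x3 minors of the rows (l, l r, r, 1) for three of the points. *)
Lemma moebius_three (I : Type) (l r : I -> K) i j k :
  l i != l j -> l i != l k -> l j != l k -> r i != r j -> r i != r k -> r j != r k ->
  (forall m, cross_eq (l i) (l j) (l k) (l m) (r i) (r j) (r k) (r m) = 0) ->
  exists2 M : 'M[K]_2, M \in unitmx & forall m, moebius_rel M (l m) (r m).
Proof.
rewrite -!(subr_eq0 (l _)) -!(subr_eq0 (r _)) => lij lik ljk rij rik rjk H.
pose det3 (x1 y1 z1 x2 y2 z2 x3 y3 z3 : K) :=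
  x1 * (y2 * z3 - z2 * y3) - y1 * (x2 * z3 - z2 * x3) + z1 * (x2 * y3 - y2 * x3).
exists (mx22 (det3 (l i * r i) (r i) 1 (l j * r j) (r j) 1 (l k * r k) (r k) 1)
             (det3 (l i) (r i) 1 (l j) (r j) 1 (l k) (r k) 1)
             (- det3 (l i) (l i * r i) (r i) (l j) (l j * r j) (r j) (l k) (l k * r k) (r k))
             (- det3 (l i) (l i * r i) 1 (l j) (l j * r j) 1 (l k) (l k * r k) 1)).
  rewrite unitmx2 !mxE /= /det3.
  (* The determinant of the matrix factors into these differences. *)
  suff : (l i - l j) * (l i - l k) * (l j - l k) * ((r i - r j) * (r i - r k) * (r j - r k)) != 0.
    by apply: contra => /eqP e; apply/eqP; rewrite -[RHS]e; ring.
  by rewrite !mulf_neq0.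
move=> m; rewrite /moebius_rel !mxE /= /det3; apply/eqP; rewrite -subr_eq0; apply/eqP.
by rewrite -oppr0 -(H m) /cross_eq; ring.
Qed.

(** * Matching two tuples of 2N points *)

Section TwoTuples.
Variables (N : nat) (l r : 'I_(N + N) -> K).
Hypothesis N0 : (0 < N)%N.
Hypothesis lN : forall x, (#|[set i | l i == x]| <= N)%N.
Hypothesis rH : forall x, (N <= #|[set i | r i == x]|)%N ->
  exists y1 y2, forall i, r i = y1 \/ r i = y2.
Hypothesis rl : forall i j, r i = r j -> l i = l j.
Hypothesis crl : forall i j k m, cross_eq (l i) (l j) (l k) (l m) (r i) (r j) (r k) (r m) = 0.

(** The block of [j0] has at most N elements, so that of [i0] has at least N, and [rH] leaves [r] at
    most two values. By [rl] the block of [j0] avoids the value [r i0], so [r] is constant there too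
    and an affine map suffices. *)
Lemma moebius_two i0 j0 : l i0 != l j0 -> (forall i, l i = l i0 \/ l i = l j0) ->
  (forall i, l i = l i0 -> r i = r i0) ->
  exists2 M : 'M[K]_2, M \in unitmx & forall m, moebius_rel M (l m) (r m).
Proof.
move=> lij l2 ri.
pose A := [set i | l i == l i0].
have cA : (N <= #|A|)%N.
  have := cardsC A; rewrite card_ord; suff : (#|~: A| <= N)%N by lia.
  rewrite (leq_trans _ (lN (l j0))) // subset_leq_card //; apply/fintype.subsetP => i.
  rewrite !inE; case: (l2 i) => ->; rewrite ?eqxx //.
have sA : A \subset [set i | r i == r i0].
  by apply/fintype.subsetP => i; rewrite !inE => /eqP/ri ->.
have [y1 [y2 y12]] : exists y1 y2, forall i, r i = y1 \/ r i = y2.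
  by apply: (rH (x := r i0)); exact: leq_trans cA (subset_leq_card sA).
have nri i : l i = l j0 -> r i != r i0.
  move=> li; apply: contra lij => /eqP e; rewrite -li; apply/eqP/esym; exact: rl.
have rj i : l i = l j0 -> r i = r j0.
  move=> /nri n1; have := nri j0 erefl.
  by case: (y12 i) (y12 j0) (y12 i0) n1 => [->|->] [->|->] [->|->] //; rewrite eqxx.
have r0 : r i0 - r j0 != 0 by rewrite subr_eq0 eq_sym nri.
pose D := (l i0 - l j0) / (r i0 - r j0).
have D0 : D != 0 by rewrite mulf_neq0 ?invr_eq0 // subr_eq0.
exists (mx22 1 0 (r i0 * D - l i0) D).
  by rewrite unitmx2 !mxE /= mul1r mul0r subr0.
move=> m; rewrite /moebius_rel !mxE /= mulr0 subr0 mulr1.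
case: (l2 m) => e; first by rewrite e (ri m e); ring.
by rewrite e (rj m e) /D; field.
Qed.

(** Three distinct values of [l] determine the map. Otherwise [l] has exactly two values, as none
    fills all 2N places, and it remains to find a block on which [r] is constant. *)
Lemma moebius_exists : exists2 M : 'M[K]_2, M \in unitmx & forall m, moebius_rel M (l m) (r m).
Proof.
have lr i j : l i != l j -> r i != r j by apply: contra => /eqP/rl ->.
case: (boolP [exists i, exists j, exists k, [&& l i != l j, l i != l k & l j != l k]]).
  move=> /existsP[i /existsP[j /existsP[k /and3P[lij lik ljk]]]].
  by apply: (moebius_three (i := i) (j := j) (k := k)); auto.
move=> n3.
pose i0 : 'I_(N + N) := Ordinal (leq_trans N0 (leq_addr N N)).
have [j0 lij] : exists j0, l i0 != l j0.
  apply: contrapT => H; have := lN (l i0); rewrite (_ : [set i | _] = finset.setT).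
    by rewrite cardsT card_ord; lia.
  apply/setP => i; rewrite !inE; apply/negP => /negP ne; apply: H; exists i.
  by rewrite eq_sym.
have l2 i : l i = l i0 \/ l i = l j0.
  have [->|n1] := eqVneq (l i) (l i0); first by left.
  have [->|n2] := eqVneq (l i) (l j0); first by right.
  case/negP: n3; apply/existsP; exists i; apply/existsP; exists i0; apply/existsP; exists j0.
  by rewrite n1 n2.
case: (boolP [forall i, (l i == l i0) ==> (r i == r i0)]) => [/forallP H|].
  by apply: (moebius_two lij l2) => i li; apply/eqP/(implyP (H i)); rewrite li.
rewrite negb_forall; case/existsP=> i; rewrite negb_imply => /andP[/eqP li ri].
apply: (@moebius_two j0 i0); first by rewrite eq_sym.
  by move=> k; case: (l2 k); auto.
move=> j lj; apply/eqP; apply/negP => /negP rj.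
(* As [l i = l i0], one term vanishes; as [r i != r i0], the other forces [r j = r j0]. So [r] is
   constant on the block of [j0]. *)
have := crl i j i0 j0; rewrite /cross_eq li lj subrr !mul0r subr0 => /eqP.
by rewrite !mulf_eq0 !subr_eq0 (negbTE lij) (negbTE ri) (negbTE rj).
Qed.

End TwoTuples.
End Moebius.

(** * Separating an orbit from a form *)

Section OrbitClosed.
Variable K : numClosedFieldType.
Implicit Types (a b : nat -> K) (z : 'rV[K]_2) (M g : 'M[K]_2).

Definition equivalent d a b := exists2 M, M \in unitmx &
  forall z, apolar d b (linpoly z ^+ d) = apolar d a (linpoly (z *m M) ^+ d).

(** The root of multiplicity at least N is a row of an invertible matrix rather than an affine
    coordinate, which makes the property stable under substitution. *)
Definition two_roots N a := forall M (r : {poly K}), M \in unitmx ->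
  (forall y, apolar (N + N) a (linpoly (row 0 M + y *: row 1 M) ^+ (N + N)) = y ^+ N * r.[y]) ->
  exists c (A B : 'cV[K]_2), forall z,
    apolar (N + N) a (linpoly z ^+ (N + N)) = c * ((z *m A) 0 0 * (z *m B) 0 0) ^+ N.

Lemma apolar_splits d a (r : d.-tuple K) z : (0 < d)%N -> splits a r ->
  apolar d a (linpoly z ^+ d) = a 0%N * \prod_(i < d) (z 0 0 - tnth r i * z 0 1).
Proof.
move=> d0 sr; have [z1|z1] := eqVneq (z 0 1) 0.
  rewrite apolar_exp_lin big_ord_recl /= z1 expr0 mulr1 subn0 bin0 mulr1n big1 ?addr0; last first.
    by move=> i _; rewrite expr0n /= mulr0 mul0rn.
  by rewrite (eq_bigr (fun=> z 0 0)) ?prodr_const ?card_ord // => i _; rewrite mulr0 subr0.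
pose y : 'rV[K]_2 := (z 0 1)^-1 *: z.
have -> : z = z 0 1 *: y by rewrite scalerA mulfV ?scale1r.
rewrite linpolyZ exprZn linearZ /= -(@horner_dehom _ d a (z 0 0 / z 0 1)); last 2 first.
- by rewrite mxE mulrC.
- by rewrite mxE mulVf.
rewrite (sr : dehom d a = _) hornerZ horner_prod big_tuple mulrCA; congr (_ * _).
have -> : z 0 1 ^+ d = \prod_(i < d) z 0 1 by rewrite prodr_const card_ord.
rewrite -big_split.
by apply: eq_bigr => i _; rewrite /= !mxE hornerXsubC; field.
Qed.

Lemma root_multiplicity d a (r : d.-tuple K) x m : splits a r ->
  (m <= #|[set i | tnth r i == x]|)%N ->
  exists q : {poly K}, dehom d a = ('X - x%:P) ^+ m * q.
Proof.
move=> sr mr; rewrite (sr : dehom d a = _) big_tuple (bigID (fun i => tnth r i == x)) /=.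
rewrite (eq_bigr (fun=> 'X - x%:P)) => [|i /eqP -> //].
rewrite prodr_const -(subnK (_ : (m <= #|[pred i | tnth r i == x]|)%N)); last first.
  by rewrite (leq_trans mr) // cardsE.
rewrite exprD -!mulrA [X in _ *: X]mulrCA scalerAr.
by eexists.
Qed.

Lemma dehom_local d a x y :
  apolar d a (linpoly (row 0 (mx22 x 1 1 0) + y *: row 1 (mx22 x 1 1 0)) ^+ d) = (dehom d a).[x + y].
Proof. by rewrite -(@horner_dehom _ d a (x + y)) // !mxE /= ?mulr1 ?mulr0 ?addr0. Qed.

Lemma mx22_local_unit (x : K) : mx22 x 1 1 0 \in unitmx.
Proof. by rewrite unitmx2 !mxE /= mulr0 sub0r mulr1 oppr_eq0 oner_eq0. Qed.

Lemma local_factor d a x m (q : {poly K}) : dehom d a = ('X - x%:P) ^+ m * q ->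
  forall y, apolar d a (linpoly (row 0 (mx22 x 1 1 0) + y *: row 1 (mx22 x 1 1 0)) ^+ d)
    = y ^+ m * (q \Po ('X + x%:P)).[y].
Proof.
move=> e y; rewrite dehom_local e hornerM horner_exp hornerXsubC horner_comp hornerD hornerX hornerC.
by rewrite addrAC subrr add0r [x + y]addrC.
Qed.

(** A root of multiplicity above N makes the N-th power of its linear form orthogonal to all forms
    of degree N, against non-degeneracy. *)
Lemma root_multiplicity_le N a (r : (N + N).-tuple K) x : \det (hankel N a) != 0 -> splits a r ->
  (#|[set i | tnth r i == x]| <= N)%N.
Proof.
move=> da sr; rewrite leqNgt; apply/negP => /(root_multiplicity sr)[q /local_factor e].
have := apolar_root _ e; rewrite ltnS leq_addr => /(_ isT)/(apolar_mul0 (mx22_local_unit x)) H.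
have l0 : linpoly (row 0 (mx22 x 1 1 0)) ^+ N = 0.
  apply: (hankel_nondegenerate _ _ H); first by rewrite unitmxE unitfE.
  exact/size_linear_exp_leq/size_linpoly.
have := congr1 (fun p : {poly K} => p.[0]) l0; rewrite horner_exp horner0 /linpoly !mxE /=.
rewrite hornerD hornerC hornerZ hornerX mulr0 addr0 expr1n => /eqP.
by rewrite oner_eq0.
Qed.

Lemma two_roots_splits N a (r : (N + N).-tuple K) x : (0 < N)%N -> a 0%N != 0 -> two_roots N a -> splits a r ->
  (N <= #|[set i | tnth r i == x]|)%N -> exists y1 y2, forall i, tnth r i = y1 \/ tnth r i = y2.
Proof.
move=> N0 a0 Ha sr /(root_multiplicity sr)[q /local_factor e].
have [c [A [B cAB]]] := Ha _ _ (mx22_local_unit x) e.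
have z2E (C : 'cV[K]_2) z : (z *m C) 0 0 = z 0 0 * C 0 0 + z 0 1 * C 1 0.
  rewrite mxE big_ord_recl big_ord1; congr (_ + z _ _ * C _ _); exact/val_inj.
(* The value at (1, 0) is [a 0], which is non-zero; so both linear forms have affine zeros. *)
have nz : (c != 0) && (A 0 0 != 0) && (B 0 0 != 0).
  have := cAB (delta_mx 0 0); rewrite (apolar_splits _ _ sr) ?addn_gt0 ?N0 // !z2E !mxE /=.
  rewrite !mul0r !addr0 !mul1r big1 ?mulr1 => [e0|i _]; last by rewrite mulr0 subr0.
  by move: a0; rewrite e0 mulf_eq0 expf_eq0 N0 /= !negb_or mulf_eq0 negb_or andbA.
exists (- A 1 0 / A 0 0), (- B 1 0 / B 0 0) => i.
move: nz => /andP[/andP[c0 A0] B0].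
have := cAB (\row_j if j == 0 then tnth r i else 1).
rewrite (apolar_splits _ _ sr) ?addn_gt0 ?N0 // !z2E !mxE /= !mul1r (bigD1 i) //= mulr1 subrr mul0r mulr0.
move/eqP; rewrite eq_sym mulf_eq0 (negbTE c0) expf_eq0 N0 /= mulf_eq0.
case/orP => /eqP e0; [left|right].
  by apply: (mulIf A0); rewrite divfK //; apply/eqP; rewrite -subr_eq0 opprK e0.
by apply: (mulIf B0); rewrite divfK //; apply/eqP; rewrite -subr_eq0 opprK e0.
Qed.

Lemma moebius_equivalent d a b (r l : d.-tuple K) (s : 'S_d) M : (0 < d)%N ->
  a 0%N != 0 -> b 0%N != 0 -> splits a r -> splits b l -> M \in unitmx ->
  (forall i, moebius_rel M (tnth l (s i)) (tnth r i)) -> equivalent d a b.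
Proof.
move=> d0 a0 b0 sr sl uM H.
have u0 i : M 0 0 - tnth r i * M 0 1 != 0.
  move: uM; rewrite unitmx2; apply: contra => /eqP u0; move: (H i).
  rewrite /moebius_rel u0 mulr0 => /esym/eqP; rewrite subr_eq0 => /eqP <-.
  by rewrite (subr0_eq u0); apply/eqP; ring.
pose c := a 0%N * \prod_(i < d) (M 0 0 - tnth r i * M 0 1).
have c0 : c != 0 by rewrite mulf_neq0 //; apply/prodf_neq0 => i _.
(* Equal roots determine a form up to a scalar, and a d-th root of the scalar is absorbed into
   [M]. *)
pose k := d.-root (b 0%N / c).
have kd : k ^+ d = b 0%N / c by rewrite rootCK.
have k0 : k != 0.
  by apply/negP => /eqP k0; move/eqP: kd; rewrite k0 expr0n gtn_eqF // eq_sym mulf_eq0 invr_eq0 (negbTE b0) (negbTE c0).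
exists (k *: M); first by rewrite unitmxZ // unitfE.
move=> z; rewrite -scalemxAr linpolyZ exprZn linearZ /= kd.
rewrite (apolar_splits _ _ sr) // (apolar_splits _ _ sl) //.
rewrite [X in _ * X = _](reindex_inj (@perm_inj _ s)) /=.
rewrite [X in _ = _ * (_ * X)](eq_bigr (fun i => (M 0 0 - tnth r i * M 0 1) * (z 0 0 - tnth l (s i) * z 0 1))).
  rewrite big_split /=.
  by rewrite (mulrA (a 0%N)) -/c mulrA divfK.
move=> i _; have e1 : lift ord0 ord0 = 1 :> 'I_2 by apply/val_inj.
rewrite !mxE !big_ord_recl !big_ord0 e1 !addr0.
transitivity (z 0 0 * (M 0 0 - tnth r i * M 0 1) - z 0 1 * (tnth r i * M 1 1 - M 1 0)); first by ring.
by rewrite -H; ring.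
Qed.

Lemma equivalent_roots d a b (r : d.-tuple K) : (0 < d)%N -> a 0%N != 0 -> b 0%N != 0 -> splits a r ->
  equivalent d a b -> exists2 l : d.-tuple K, splits b l &
    exists M, [/\ M \in unitmx, forall i, M 0 0 - tnth r i * M 0 1 != 0
                & forall i, moebius_rel M (tnth l i) (tnth r i)].
Proof.
move=> d0 a0 b0 sr [M uM H].
have e1 : lift ord0 ord0 = 1 :> 'I_2 by apply/val_inj.
have bE z : apolar d b (linpoly z ^+ d) = a 0%N * \prod_(i < d)
    (z 0 0 * (M 0 0 - tnth r i * M 0 1) - z 0 1 * (tnth r i * M 1 1 - M 1 0)).
  rewrite H (apolar_splits _ _ sr) //; congr (_ * _); apply: eq_bigr => i _.
  by rewrite !mxE !big_ord_recl !big_ord0 e1 !addr0; ring.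
have b0E : b 0%N = a 0%N * \prod_(i < d) (M 0 0 - tnth r i * M 0 1).
  rewrite -(apolarX b (leq0n d)) subn0; have := bE (delta_mx 0 0); rewrite /linpoly !mxE /=.
  rewrite add0r scale1r => ->; congr (_ * _); apply: eq_bigr => i _; ring.
have u0 i : M 0 0 - tnth r i * M 0 1 != 0.
  by move: b0; rewrite b0E mulf_eq0 negb_or => /andP[_ /prodf_neq0/(_ i isT)].
exists [tuple (tnth r i * M 1 1 - M 1 0) / (M 0 0 - tnth r i * M 0 1) | i < d]; last first.
  by exists M; split=> // i; rewrite /moebius_rel tnth_mktuple divfK.
apply: poly_ext => x; pose z : 'rV[K]_2 := \row_j if j == 0 then x else 1.
rewrite (@horner_dehom _ d b x z) ?mxE // bE hornerZ horner_prod big_tuple b0E -mulrA -big_split.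
congr (_ * _); apply: eq_bigr => i _.
by rewrite /= !mxE tnth_mktuple hornerXsubC /=; field.
Qed.

Lemma orbit_separation_affine N a b : (0 < N)%N -> \det (hankel N b) != 0 -> two_roots N a ->
  a 0%N != 0 -> b 0%N != 0 -> ~ equivalent (N + N) a b ->
  exists f : {mpoly K[(N + N).+1]}, f.@[fun j => b j] != 0 /\
    forall a', equivalent (N + N) a a' -> f.@[fun j => a' j] = 0.
Proof.
move=> N0 db Ha a0 b0 nab; have [r sr] := splits_exists (N + N) a0; have [l sl] := splits_exists (N + N) b0.
have d0 : (0 < N + N)%N by rewrite addn_gt0 N0.
pose I := 'I_(N + N); pose rho i := tnth r i.
(* The flag selects either a cross-ratio equation or the condition that equal roots of [a] are
   matched with equal values. *)
pose E (t : I * I * I * I * bool) : {mpoly K[N + N]} :=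
  let: (i, j, k, m, c) := t in
  if c then ((rho i - rho k) * (rho j - rho m)) *: (('X_i - 'X_j) * ('X_k - 'X_m))
       - ((rho i - rho j) * (rho k - rho m)) *: (('X_i - 'X_k) * ('X_j - 'X_m))
  else (rho i == rho j)%:R *: ('X_i - 'X_j).
have E1 i j k m v : (E (i, j, k, m, true)).@[v] =
    cross_eq (v i) (v j) (v k) (v m) (rho i) (rho j) (rho k) (rho m).
  by rewrite /E mevalB !mevalZ !mevalM !mevalB !mevalXU /cross_eq; ring.
have E0 i j k m v : (E (i, j, k, m, false)).@[v] = (rho i == rho j)%:R * (v i - v j).
  by rewrite /E mevalZ mevalB !mevalXU.
apply: (@root_condition_separates K (N + N) _ E (equivalent (N + N) a) b l) => //.
  move=> a' aa' a'0; have [l' sl' [M [uM u0 H]]] := equivalent_roots d0 a0 a'0 sr aa'.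
  exists l' => //.
  have lE i : tnth l' i = (rho i * M 1 1 - M 1 0) / (M 0 0 - rho i * M 0 1).
    by rewrite -(H i) mulfK.
  case=> -[[[i j] k] m] [|]; last first.
    rewrite E0; case: eqP => [e|_]; last by rewrite mul0r.
    by rewrite !lE e subrr mulr0.
  (* A Moebius map multiplies a difference by a constant and one factor per point, so both terms of
     [cross_eq] scale alike. *)
  have dE x y : tnth l' x - tnth l' y = (M 0 0 * M 1 1 - M 0 1 * M 1 0) * (rho x - rho y)
      * ((M 0 0 - rho x * M 0 1)^-1 * (M 0 0 - rho y * M 0 1)^-1).
    by rewrite !lE; move: (u0 x) (u0 y); rewrite -!/(rho _) => ux uy; field; rewrite uy ux.
  by rewrite E1 /cross_eq !dE; ring.
move=> s; apply: contrapT => ns; apply: nab.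
have Es t : (E t).@[fun j => tnth l (s j)] = 0.
  by apply/eqP/negP => /negP nt; apply: ns; exists t.
have [M uM HM] : exists2 M : 'M[K]_2, M \in unitmx & forall i, moebius_rel M (tnth l (s i)) (rho i).
  apply: (moebius_exists N0 (l := fun i => tnth l (s i))).
  - move=> x; apply: leq_trans (root_multiplicity_le x db sl).
    rewrite -(card_imset _ (@perm_inj _ s)) subset_leq_card //.
    by apply/fintype.subsetP => _ /imsetP[i + ->]; rewrite !inE.
  - move=> x; exact: (two_roots_splits N0 a0 Ha sr).
  - move=> i j e; have := Es (i, j, j, j, false); rewrite E0 e eqxx mul1r.
    by move/eqP; rewrite subr_eq0 => /eqP.
  - by move=> i j k m; have := Es (i, j, k, m, true); rewrite E1.
exact: moebius_equivalent uM HM.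
Qed.

End OrbitClosed.

(** * Reduction to forms that do not vanish at (1, 0) *)

Section Separation.
Variable K : numClosedFieldType.
Implicit Types (a b : nat -> K) (M g : 'M[K]_2).

Lemma two_roots_twist N a g : g \in unitmx -> two_roots N a -> two_roots N (twist (N + N) a g).
Proof.
move=> ug Ha M r uM e.
have [||c [A [B cAB]]] := Ha (M *m g) r.
- by rewrite unitmx_mul uM.
- by move=> y; rewrite !row_mul scalemxAl -mulmxDl -apolar_twist.
exists c, (g *m A), (g *m B) => z.
by rewrite apolar_twist cAB !mulmxA.
Qed.

Lemma twist_equivalent d a g : g \in unitmx -> equivalent d a (twist d a g).
Proof. by move=> ug; exists g => // z; rewrite apolar_twist. Qed.

Lemma equivalent_trans d a b c : equivalent d a b -> equivalent d b c -> equivalent d a c.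
Proof.
move=> [M uM HM] [L uL HL]; exists (L *m M); first by rewrite unitmx_mul uL.
by move=> z; rewrite HL HM mulmxA.
Qed.

Lemma equivalent_sym d a b : equivalent d a b -> equivalent d b a.
Proof.
move=> [M uM HM]; exists (invmx M); first by rewrite unitmx_inv.
by move=> z; rewrite HM mulmxKV.
Qed.

Lemma hankel_neq0 N a : \det (hankel N a) != 0 -> exists2 k, (k <= N + N)%N & a k != 0.
Proof.
move=> da; apply: contrapT => H; case/eqP: da.
rewrite (_ : hankel N a = 0) ?det0 //; apply/matrixP => i j; rewrite !mxE.
apply/eqP/negP => /negP nz; apply: H; exists (i + j)%N => //.
by have := ltn_ord i; have := ltn_ord j; lia.
Qed.

Definition shear (c : K) := mx22 1 c 0 1.

Lemma shear_unit c : shear c \in unitmx.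
Proof. by rewrite unitmx2 !mxE /= mulr1 mulr0 subr0 oner_eq0. Qed.

Lemma twist_shear0 d a c : twist d a (shear c) 0 = (\sum_(j < d.+1) (a j *+ 'C(d, j)) *: 'X^j).[c].
Proof.
rewrite /twist expr0 mulr1 subn0 apolar_exp_lin horner_sum; apply: eq_bigr => j _.
by rewrite !mxE /= hornerZ hornerXn expr1n; ring.
Qed.

(** The new leading coefficient is the value at (1, c), a non-zero polynomial in [c] for each form;
    a non-root of the product serves both. *)
Lemma exists_shear N a b : \det (hankel N a) != 0 -> \det (hankel N b) != 0 ->
  exists c, twist (N + N) a (shear c) 0 != 0 /\ twist (N + N) b (shear c) 0 != 0.
Proof.
move=> /hankel_neq0[k kN ak] /hankel_neq0[k' kN' bk].
pose p (e : nat -> K) : {poly K} := \sum_(j < (N + N).+1) (e j *+ 'C(N + N, j)) *: 'X^j.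
have p0 e i : (i <= N + N)%N -> e i != 0 -> p e != 0.
  move=> iN ei; apply: contra ei => /eqP pe0; have := congr1 (fun q : {poly K} => q`_i) pe0.
  rewrite coef0 /p -(@poly_def _ _ (fun j => e j *+ 'C(N + N, j))) coef_poly ltnS iN => /eqP.
  by rewrite mulrn_eq0 -leqn0 leqNgt bin_gt0 iN.
have [c pc] : exists c, (p a * p b).[c] != 0.
  apply: contrapT => H; have : p a * p b != 0 by apply: mulf_neq0; [exact: p0 kN ak | exact: p0 kN' bk].
  case/eqP; apply: poly_ext => x; rewrite horner0; apply/eqP/negP => /negP nx.
  by apply: H; exists x.
by exists c; move: pc; rewrite hornerM mulf_eq0 negb_or !twist_shear0 => /andP[].
Qed.

Definition twist_mpoly d M (f : {mpoly K[d.+1]}) : {mpoly K[d.+1]} :=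
  f \mPo [tuple \sum_(k < d.+1)
    (linpoly (row 0 M) ^+ (d - j) * linpoly (row 1 M) ^+ j)`_(d - k) *: 'X_k | j < d.+1].

Lemma meval_twist d a M (f : {mpoly K[d.+1]}) :
  (twist_mpoly M f).@[fun k => a k] = f.@[fun j => twist d a M j].
Proof.
rewrite /twist_mpoly comp_mpoly_meval; apply: meval_eq => j; rewrite tnth_mktuple raddf_sum.
by apply: eq_bigr => k _; rewrite /= mevalZ mevalXU mulrC.
Qed.

Lemma orbit_separation N a b : (0 < N)%N -> \det (hankel N a) != 0 -> \det (hankel N b) != 0 ->
  two_roots N a -> ~ equivalent (N + N) a b ->
  exists f : {mpoly K[(N + N).+1]}, f.@[fun j => b j] != 0 /\
    forall a', equivalent (N + N) a a' -> f.@[fun j => a' j] = 0.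
Proof.
move=> N0 da db Ha nab; have [c [ac bc]] := exists_shear da db.
have ug := shear_unit c.
have tw e := twist_equivalent (N + N) e ug.
have nab' : ~ equivalent (N + N) (twist (N + N) a (shear c)) (twist (N + N) b (shear c)).
  move=> eab; apply: nab; apply: equivalent_trans (tw a) (equivalent_trans eab _).
  exact/equivalent_sym/tw.
have [f [fb fa]] :=
  orbit_separation_affine N0 (hankel_twist_unit ug db) (two_roots_twist ug Ha) ac bc nab'.
exists (twist_mpoly (shear c) f); split; first by rewrite meval_twist.
move=> a' aa'; rewrite meval_twist; apply: fa.
exact: equivalent_trans (equivalent_sym (tw a)) (equivalent_trans aa' (tw a')).
Qed.

End Separation.

(** * Binary forms as graded univariate polynomials *)

Section Grading.
Variable K : numClosedFieldType.
Implicit Types (p : {mpoly K[2]}) (h : {poly K}).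

Definition mnm2 i j : 'X_{1..2} := [multinom (if val k == 0 then i else j)%N | k < 2].

Lemma mnm2E (mm : 'X_{1..2}) : mm = mnm2 (mm 0) (mm 1).
Proof.
apply/mnmP => k; rewrite mnmE; case: k => [[|[|//]] ?] /=; congr (mm _); exact/val_inj.
Qed.

Lemma mdeg_mnm2 i j : mdeg (mnm2 i j) = (i + j)%N.
Proof. by rewrite mdegE big_ord_recl big_ord1 !mnmE. Qed.

Lemma mnm2_U0 i j : (mnm2 i j + U_(0%R))%MM = mnm2 i.+1 j.
Proof. by apply/mnmP; case=> [[|[|//]] ?]; rewrite mnmDE !mnmE /= ?addn1 ?addn0. Qed.

Lemma mnm2_U1 i j : (mnm2 i j + U_(1%R))%MM = mnm2 i j.+1.
Proof. by apply/mnmP; case=> [[|[|//]] ?]; rewrite mnmDE !mnmE /= ?addn1 ?addn0. Qed.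

(* The substitution [X_0 := x s, X_1 := s]: the coefficient of [s^e] is the dehomogenization of the component of degree [e]. *)
Definition graded : {mpoly K[2]} -> {poly {poly K}} :=
  mmap ((@polyC {poly K}) \o (@polyC K)) (fun i => if val i == 0 then 'X%:P * 'X else 'X).
HB.instance Definition _ := GRing.RMorphism.copy graded
  (mmap ((@polyC {poly K}) \o (@polyC K)) (fun i : 'I_2 => if val i == 0 then 'X%:P * 'X else 'X)).

Lemma gradedD : {morph graded : p p' / p + p'}. Proof. exact: rmorphD. Qed.
Lemma gradedB : {morph graded : p p' / p - p'}. Proof. exact: rmorphB. Qed.
Lemma gradedN : {morph graded : p / - p}. Proof. exact: rmorphN. Qed.
Lemma gradedM : {morph graded : p p' / p * p'}. Proof. exact: rmorphM. Qed.
Lemma gradedXn k : {morph graded : p / p ^+ k}. Proof. exact: rmorphXn. Qed.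
Lemma graded1 : graded 1 = 1. Proof. exact: rmorph1. Qed.

Lemma gradedX mm : graded 'X_[mm] = ('X ^+ mm 0)%:P * 'X^(mm 0%R + mm 1%R)%N.
Proof.
rewrite /graded mmapX /mmap1 big_ord_recl big_ord1 /= exprMn exprD mulrA -rmorphXn.
by congr (_ * _ * 'X^(mm _)); apply/val_inj.
Qed.

Lemma coef_graded p e i : (graded p)`_e`_i = if (i <= e)%N then p@_(mnm2 i (e - i)) else 0.
Proof.
rewrite {1}(mpolyE p) raddf_sum /= !coef_sum.
transitivity (\sum_(mm <- msupp p) if (i <= e)%N && (mm == mnm2 i (e - i)) then p@_mm else 0).
  apply: eq_bigr => mm _; rewrite /= -mul_mpolyC rmorphM /= gradedX.
  rewrite {1}/graded mmapC /= mulrA -rmorphM /= coefMXn.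
  have -> : ((i <= e)%N && (mm == mnm2 i (e - i))) = ((e == mm 0%R + mm 1%R)%N && (i == mm 0%R)).
    apply/andP/andP => [[ie /eqP->]|[/eqP-> /eqP->]].
      by rewrite !mnmE /= subnKC ?eqxx.
    by rewrite leq_addr addKn -mnm2E.
  case: ltnP => [lt|ge]; first by rewrite coef0 ltn_eqF.
  rewrite coefC subn_eq0 eqn_leq ge andbT; case: ifP => _; last by rewrite coef0.
  by rewrite coefCM coefXn; case: eqP; rewrite /= ?mulr1 ?mulr0.
case: leqP => /= _; last by rewrite big1.
transitivity (\sum_(mm <- msupp p) p@_mm *: 'X_[mm])@_(mnm2 i (e - i)); last by rewrite -mpolyE.
rewrite raddf_sum; apply: eq_bigr => mm _.
by rewrite /= mcoeffZ mcoeffX; case: eqP; rewrite ?mulr1 ?mulr0.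
Qed.

Lemma size_graded p e : (size ((graded p)`_e)%R <= e.+1)%N.
Proof. by apply/leq_sizeP => j ej; rewrite coef_graded leqNgt ej. Qed.

Lemma graded_inj : injective graded.
Proof.
move=> p p' e; apply/mpolyP => mm; rewrite (mnm2E mm).
have := congr1 (fun q : {poly {poly K}} => q`_(mm 0%R + mm 1%R)%N`_(mm 0%R)) e.
by rewrite !coef_graded leq_addr addKn.
Qed.

Definition hform e h : {mpoly K[2]} := \sum_(i < e.+1) h`_i *: 'X_[mnm2 i (e - i)].

Lemma graded_hform e h : (size h <= e.+1)%N -> graded (hform e h) = h%:P * 'X^e.
Proof.
move=> sh; rewrite raddf_sum /=.
rewrite (eq_bigr (fun i : 'I_e.+1 => (h`_i *: 'X^i)%:P * 'X^e)) => [|i _].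
  rewrite -mulr_suml -rmorph_sum /= -poly_def; congr (_%:P * _).
  by apply/polyP => k; rewrite coef_poly; case: ltnP => // /(leq_trans sh)/(nth_default _) ->.
rewrite -mul_mpolyC rmorphM /= gradedX {1}/graded mmapC /= mulrA -rmorphM /= (mul_polyC h`_i) !mnmE /=.
by rewrite subnKC // -ltnS.
Qed.

Lemma graded_deriv0 p e : (graded p^`M(0))`_e = ((graded p)`_e.+1)^`().
Proof.
apply/polyP => i; rewrite coef_deriv !coef_graded ltnS; case: leqP => // ie; last by rewrite mul0rn.
by rewrite mcoeff_deriv mnm2_U0 mnmE.
Qed.

(** Euler's identity at z_2 = 1. *)
Lemma graded_deriv1 p e :
  (graded p^`M(1))`_e = (graded p)`_e.+1 *+ e.+1 - 'X * ((graded p)`_e.+1)^`().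
Proof.
apply/polyP => i; rewrite coefB coefMn coefXM coef_deriv !coef_graded.
have -> : (if i == 0 then 0 else (if (i.-1.+1 <= e.+1)%N then p@_(mnm2 i.-1.+1 (e.+1 - i.-1.+1)) else 0) *+ i.-1.+1)
   = (if (i <= e.+1)%N then p@_(mnm2 i (e.+1 - i)) else 0) *+ i.
  by case: i => [|i] //=; rewrite ?mulr0n.
have [ie|] := leqP i e; last first.
  rewrite leq_eqVlt => /orP[/eqP <-|ei]; first by rewrite leqnn subrr.
  by rewrite leqNgt ei !mul0rn subrr.
have ie1 := leqW ie; rewrite ie1 -(mulrnBr _ ie1) mcoeff_deriv mnm2_U1 subSn //.
by rewrite mnmE.
Qed.

Lemma graded_dhomog e (P : binform K e) :
  graded P = ((graded P)`_e)%:P * 'X^e.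
Proof.
apply/polyP => k; rewrite coefMXn coefC.
case: ltnP => [ke|ek].
  apply/polyP => i; rewrite coef_graded coef0; case: leqP => // ik.
  apply: (dhomog_nemf_coeff (dhomog_is_dhomog P)); rewrite /= mdeg_mnm2 subnKC //.
  by rewrite ltn_eqF.
rewrite subn_eq0; have [ke|ke] := leqP k e; first by congr (_`__); apply/eqP; rewrite eqn_leq ke.
apply/polyP => i; rewrite coef_graded coef0; case: leqP => // ik.
apply: (dhomog_nemf_coeff (dhomog_is_dhomog P)); rewrite /= mdeg_mnm2 subnKC //.
by rewrite gtn_eqF.
Qed.

Lemma dhomogE2 e p h : (size h <= e.+1)%N -> graded p = h%:P * 'X^e -> p = hform e h.
Proof. by move=> sh gp; apply: graded_inj; rewrite graded_hform. Qed.

Lemma meval_hform e h (z : 'I_2 -> K) :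
  (hform e h).@[z] = \sum_(i < e.+1) h`_i * z 0 ^+ i * z 1 ^+ (e - i).
Proof.
rewrite /hform raddf_sum; apply: eq_bigr => i _.
rewrite /= mevalZ mevalX big_ord_recl big_ord1 !mnmE /= mulrA.
by congr (_ * _ * z _ ^+ _); apply/val_inj.
Qed.

Lemma meval_hform_dehom d a (z : 'rV[K]_2) :
  (hform d (dehom d a)).@[z 0] = apolar d a (linpoly z ^+ d).
Proof.
rewrite meval_hform apolar_exp_lin (reindex_inj rev_ord_inj) /=; apply: eq_bigr => j _.
have jd : (j <= d)%N by rewrite -ltnS.
by rewrite subSS coef_dehom // subKn // -!mulrnAl.
Qed.

Lemma feval_apolar e (P : binform K e) z : feval (P : {mpoly K[2]}) z = apolar e (bcoef P) (linpoly z ^+ e).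
Proof.
have -> : (P : {mpoly K[2]}) = hform e (graded P)`_e.
  by apply: dhomogE2; [exact: size_graded|exact: graded_dhomog].
rewrite /feval meval_hform apolar_exp_lin (reindex_inj rev_ord_inj) /=.
apply: eq_bigr => j _; have je : (j <= e)%N by rewrite -ltnS.
rewrite coef_graded subSS leq_subr subKn // /bcoef -/(mnm2 _ _).
rewrite -mulr_natr; field.
by rewrite pnatr_eq0 -lt0n bin_gt0.
Qed.

Lemma graded_deriv_hom p h e : graded p = h%:P * 'X^(e.+1) ->
  graded (p^`M(0)) = (h^`())%:P * ('X^e) /\ graded (p^`M(1)) = (h *+ e.+1 - 'X * h^`())%:P * 'X^e.
Proof.
move=> ph; have pE k : (graded p)`_k.+1 = if k == e then h else 0.
  rewrite ph coefMXn coefC ltnS subSS; case: (ltngtP k e) => [//|ke|->]; last by rewrite subnn.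
  by rewrite subn_eq0 leqNgt ke.
have cE (u : {poly K}) k : (u%:P * 'X^e)`_k = if k == e then u else 0.
  rewrite coefMXn coefC; case: (ltngtP k e) => [//|ke|->]; last by rewrite subnn.
  by rewrite subn_eq0 leqNgt ke.
split; apply/polyP => k; rewrite cE.
  by rewrite graded_deriv0 pE; case: eqP => // _; rewrite deriv0.
by rewrite graded_deriv1 pE; case: eqP => [->|] // _; rewrite deriv0 mulr0 mul0rn subr0.
Qed.

(** An ideal generated by forms is homogeneous, so membership is tested degree by degree. *)
Lemma graded_pencil (P1 P2 p : {mpoly K[2]}) d u v :
  graded P1 = u%:P * 'X^d -> graded P2 = v%:P * 'X^d ->
  (exists a b, p = a * P1 + b * P2) <-> forall e, pencil_ideal d u v e (graded p)`_e.
Proof.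
move=> gP1 gP2; split=> [[a [b ->]] e|H].
  rewrite rmorphD !rmorphM /= gP1 gP2 coefD !mulrA !coefMXn.
  case: ltnP => ne; first by rewrite addr0; exact: pencil_ideal0.
  rewrite !coefMC; exists (graded a)`_(e - d), (graded b)`_(e - d).
  by rewrite subSn // !size_graded.
have [ab abP] : exists ab : nat -> {poly K} * {poly K}, forall e,
    [/\ (size (ab e).1 <= e.+1 - d)%N, (size (ab e).2 <= e.+1 - d)%N &
     (graded p)`_e = (ab e).1 * u + (ab e).2 * v].
  have /choice[ab H'] : forall e, exists ab : {poly K} * {poly K},
      [/\ (size ab.1 <= e.+1 - d)%N, (size ab.2 <= e.+1 - d)%N &
       (graded p)`_e = ab.1 * u + ab.2 * v].
    by move=> e; have [a [b ?]] := H e; exists (a, b).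
  by exists ab.
have low (h : {poly K}) e k : (size h <= e.+1 - d)%N -> graded (hform (e - d) h) * (k%:P * 'X^d) = (h * k)%:P * 'X^e.
  have [->|h0 sh] := eqVneq h 0.
    by rewrite mul0r rmorph0 mul0r (_ : hform _ _ = 0) ?rmorph0 ?mul0r // /hform big1 // => i _; rewrite coef0 scale0r.
  have ne : (d <= e)%N by move: h0; rewrite -size_poly_gt0; lia.
  rewrite graded_hform -?subSn // rmorphM /= mulrACA -exprD subnK //.
exists (\sum_(e < size (graded p)) hform (e - d) (ab e).1), (\sum_(e < size (graded p)) hform (e - d) (ab e).2).
apply: graded_inj; rewrite rmorphD !rmorphM !rmorph_sum /= gP1 gP2.
rewrite !mulr_suml -big_split /= -[LHS]coefK poly_def; apply: eq_bigr => e _.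
have [s1 s2 ->] := abP e.
by rewrite !low // -mul_polyC rmorphD mulrDl.
Qed.

Lemma graded_det2 (P1 P2 P3 P4 : {mpoly K[2]}) u1 u2 u3 u4 d :
  graded P1 = u1%:P * 'X^d -> graded P2 = u2%:P * 'X^d ->
  graded P3 = u3%:P * 'X^d -> graded P4 = u4%:P * 'X^d ->
  graded (P1 * P4 - P2 * P3) = (u1 * u4 - u2 * u3)%:P * 'X^(d + d).
Proof.
by move=> e1 e2 e3 e4; rewrite rmorphB !rmorphM /= e1 e2 e3 e4 rmorphB !rmorphM exprD /=; ring.
Qed.

Lemma gradedZ c p e : (graded (c%:MP * p))`_e = c *: (graded p)`_e.
Proof. by rewrite gradedM {1}/graded mmapC /= coefCM mul_polyC. Qed.

Lemma graded_X0 : graded ('X_0 : {mpoly K[2]}) = 'X%:P * 'X.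
Proof. by rewrite /graded mmapX mmap1U. Qed.

Lemma graded_X1 : graded ('X_1 : {mpoly K[2]}) = 'X.
Proof. by rewrite /graded mmapX mmap1U. Qed.

Lemma coef_exp_low (A : comNzRingType) (G : {poly A}) k e : G`_0 = 0 -> (e < k)%N -> (G ^+ k)`_e = 0.
Proof.
move=> G0 ek; have /factor_theorem[G' ->] : root G 0 by rewrite /root horner_coef0 G0.
by rewrite subr0 exprMn coefMXn ek.
Qed.

Lemma hform_linear e c h h' : hform e (c *: h + h') = c%:MP * hform e h + hform e h'.
Proof.
rewrite mul_mpolyC scaler_sumr -big_split; apply: eq_bigr => i _.
by rewrite coefD coefZ scalerDl scalerA.
Qed.

Lemma hform_dhomog e h : hform e h \is e.-homog.
Proof.
apply: rpred_sum => i _; apply: rpredZ; rewrite dhomogX /= mdeg_mnm2 subnKC //.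
by rewrite -ltnS.
Qed.

End Grading.

(** * The Milnor algebra and the associated form *)

Section SecondRoot.
Variable K : numClosedFieldType.

(** With [z] expanded in the rows of [M], every binomial term but the middle one contains an N+1-st
    power of one of the two linear forms and is annihilated. *)
Lemma two_point_form N (a : nat -> K) (M : 'M[K]_2) : (0 < N)%N -> M \in unitmx ->
  (forall i (h : {poly K}), (size h <= N)%N -> apolar (N + N) a (linpoly (row i M) ^+ N.+1 * h) = 0) ->
  exists c (A B : 'cV[K]_2), forall z,
    apolar (N + N) a (linpoly z ^+ (N + N)) = c * ((z *m A) 0 0 * (z *m B) 0 0) ^+ N.
Proof.
move=> N0 uM H; set l0 := linpoly (row 0 M); set l1 := linpoly (row 1 M).
exists (apolar (N + N) a (l0 ^+ N * l1 ^+ N) *+ 'C(N + N, N)), (col 0 (invmx M)), (col 1 (invmx M)) => z.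
have cE k : (z *m col k (invmx M)) 0 0 = (z *m invmx M) 0 k.
  by rewrite !mxE; apply: eq_bigr => i _; rewrite mxE.
rewrite !cE -{1}(mulmxKV uM z) linpoly_mulmx -/l0 -/l1.
move: ((z *m invmx M) 0 0) ((z *m invmx M) 0 1) => x y.
rewrite exprDn linear_sum.
have NN : (N < (N + N).+1)%N by lia.
rewrite (bigD1 (Ordinal NN)) //= addnK big1 ?addr0.
  by rewrite raddfMn /= !exprZn -scalerAl -scalerAr scalerA linearZ /= exprMn; ring.
move=> j jN; rewrite raddfMn /= !exprZn -scalerAl -scalerAr scalerA linearZ /=.
have szE (u v : nat) : (u + v < N)%N -> (size (l0 ^+ u * l1 ^+ v)%R <= N)%N.
  move=> uv; apply: leq_trans (size_mulS_leq (size_linear_exp_leq u (size_linpoly _))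
    (size_linear_exp_leq v (size_linpoly _))) _; lia.
suff -> : apolar (N + N) a (l0 ^+ (N + N - j) * l1 ^+ j) = 0 by rewrite mulr0 mul0rn.
have jNN : (j <= N + N)%N by rewrite -ltnS.
have {jN} jN : nat_of_ord j != N by apply: contra jN => /eqP e; apply/eqP/val_inj.
have [lt|ge] := ltnP j N.
  have -> : (N + N - j = N.+1 + (N.-1 - j))%N by lia.
  by rewrite exprD -mulrA H // szE //; lia.
have -> : nat_of_ord j = (N.+1 + (j - N.+1))%N by lia.
by rewrite exprD mulrCA H // szE //; lia.
Qed.

End SecondRoot.

Section MilnorIdeal.
Variables (K : numClosedFieldType) (m : nat) (hm : (3 <= m)%N) (Q : binform K m).
Hypothesis XQ : X2 K m Q.
Implicit Types (p : {mpoly K[2]}) (h : {poly K}).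

Let N := (m - 2)%N.
Let n := N.+1.
Let q := (graded (Q : {mpoly K[2]}))`_m.
Let f := q^`().
Let g := q *+ n.+1 - 'X * q^`().
Local Notation J := (pencil_ideal n f g).

Lemma subn2K : m = N.+2.
Proof. by rewrite /N; lia. Qed.

Lemma gradedQ : graded (Q : {mpoly K[2]}) = q%:P * 'X^(n.+1).
Proof. by rewrite {1}graded_dhomog /q -subn2K. Qed.

Lemma gradedQ1 : graded (Q : {mpoly K[2]})^`M(0) = f%:P * 'X^n.
Proof. by case: (graded_deriv_hom gradedQ). Qed.

Lemma gradedQ2 : graded (Q : {mpoly K[2]})^`M(1) = g%:P * 'X^n.
Proof. by case: (graded_deriv_hom gradedQ). Qed.

Lemma size_q : (size q <= N.+3)%N.
Proof. by rewrite -subn2K; exact: size_graded. Qed.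

Lemma gradQ_nonzero (z : 'rV[K]_2) : z != 0 ->
  ~ (\sum_(i < n.+1) f`_i * z 0 0 ^+ i * z 0 1 ^+ (n - i) = 0 /\
     \sum_(i < n.+1) g`_i * z 0 0 ^+ i * z 0 1 ^+ (n - i) = 0).
Proof.
move=> z0 [e1 e2]; move/eqP: z0; apply; apply: XQ; rewrite /feval.
  by rewrite (dhomogE2 _ gradedQ1) ?meval_hform // (size_grad1 size_q).
by rewrite (dhomogE2 _ gradedQ2) ?meval_hform // (size_grad2 size_q).
Qed.

Lemma coprime_grad : coprimep f g.
Proof.
apply/negPn/negP => /closed_rootP[x]; rewrite root_gcd => /andP[/eqP fx /eqP gx].
have sum1 (h : {poly K}) : (size h <= n.+1)%N ->
    h.[x] = \sum_(i < n.+1) h`_i * x ^+ i * 1 ^+ (n - i).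
  move=> sh; rewrite (horner_coef_wide _ sh); apply: eq_bigr => i _.
  by rewrite expr1n mulr1.
apply: (@gradQ_nonzero (\row_j if j == 0 then x else 1)).
  by apply/eqP => /rowP/(_ 1); rewrite !mxE /=; apply/eqP; rewrite oner_eq0.
by rewrite !mxE /= -!sum1 ?(size_grad1 size_q) ?(size_grad2 size_q).
Qed.

Lemma top_grad : (f`_n != 0) || (g`_n != 0).
Proof.
rewrite -negb_and; apply/negP => /andP[/eqP fn /eqP gn].
have sum0 (h : {poly K}) : h`_n = 0 -> \sum_(i < n.+1) h`_i * 1 ^+ i * 0 ^+ (n - i) = 0.
  move=> hn; rewrite big1 // => i _; have [ni|ni] := leqP n i.
    have -> : nat_of_ord i = n by have := ltn_ord i; lia.
    by rewrite hn !mul0r.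
  by rewrite expr0n subn_eq0 leqNgt ni mulr0.
apply: (@gradQ_nonzero (delta_mx 0 0)).
  by apply/eqP => /rowP/(_ 0); rewrite !mxE /=; apply/eqP; rewrite oner_eq0.
by rewrite !mxE /= !sum0.
Qed.

Lemma milnor_idealP p : reflect (forall e, J e (graded p)`_e) (p \in milnor_ideal Q hm).
Proof.
apply: (iffP (asboolP _)).
  exact: (graded_pencil p gradedQ1 gradedQ2).1.
exact: (graded_pencil p gradedQ1 gradedQ2).2.
Qed.

Local Notation cl := (mclass hm Q).

Lemma mclassD p p' : cl (p + p') = cl p + cl p'.
Proof. exact: rmorphD. Qed.
Lemma mclassB p p' : cl (p - p') = cl p - cl p'.
Proof. exact: rmorphB. Qed.
Lemma mclassM p p' : cl (p * p') = cl p * cl p'.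
Proof. exact: rmorphM. Qed.
Lemma mclass1 : cl 1 = 1.
Proof. exact: rmorph1. Qed.
Lemma mclass0 : cl 0 = 0.
Proof. exact: rmorph0. Qed.

Lemma mclass_eq0 p : cl p = 0 <-> forall e, J e (graded p)`_e.
Proof.
rewrite -mclass0; split.
  move=> e0; apply/milnor_idealP; rewrite -[p]subr0 Quotient.idealrBE; exact/eqP.
by move/milnor_idealP; rewrite -[p in X in X -> _]subr0 Quotient.idealrBE => /eqP.
Qed.

Lemma mclass_surj x : exists p, x = cl p.
Proof. by exists (generic_quotient.repr x); rewrite /mclass reprK. Qed.

Lemma graded_Hess : graded (Hess Q) = (wronskian f g *+ n)%:P * 'X^(N + N).
Proof.
rewrite /Hess det_mx2 !mxE.
have [g00 g01] := graded_deriv_hom gradedQ1; have [g10 g11] := graded_deriv_hom gradedQ2.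
rewrite wronskian_mul_deg; exact: (graded_det2 g00 g01 g10 g11).
Qed.

Let N1 : (0 < N)%N. Proof. by rewrite /N; lia. Qed.
Let W := wronskian f g.

(** A non-zero constant term makes the class invertible by a finite geometric series, since all
    degrees above 2N lie in the ideal. *)
Lemma milnor_max_mclass p : milnor_max (cl p) <-> (graded p)`_0 = 0.
Proof.
split=> [H|p0 [y]]; last first.
  have [r ->] := mclass_surj y; rewrite -mclassM -mclass1 => /eqP.
  rewrite -subr_eq0 -mclassB => /eqP/mclass_eq0/(_ 0%N)/pencil_ideal_small => /(_ isT).
  rewrite gradedB gradedM graded1 coefB coef0M p0 mul0r coefC /= sub0r => /eqP.
  by rewrite oppr_eq0 oner_eq0.
apply: contrapT => p0; apply: H.
have [c ec] : exists c : K, (graded p)`_0 = c%:P.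
  by exists (graded p)`_0`_0; apply: size1_polyC; exact: size_graded.
have c0 : c != 0 by apply/eqP => c0; apply: p0; rewrite ec c0.
pose r := 1 - (c^-1)%:MP * p; pose k := (N + N).+1.
have r0 : (graded r)`_0 = 0.
  rewrite gradedB graded1 coefB gradedZ ec coefC /= -mul_polyC -polyCM mulVf //.
  by rewrite subrr.
exists (cl ((c^-1)%:MP * \sum_(i < k) r ^+ i)).
rewrite -mclassM -mclass1; apply/eqP; rewrite -subr_eq0 -mclassB; apply/eqP/mclass_eq0 => e.
have -> : p * ((c^-1)%:MP * \sum_(i < k) r ^+ i) - 1 = - r ^+ k.
  have -> : p * ((c^-1)%:MP * \sum_(i < k) r ^+ i) = - ((r - 1) * \sum_(i < k) r ^+ i).
    by rewrite /r; ring.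
  by rewrite -subrX1; ring.
rewrite gradedN gradedXn coefN.
have [ek|ke] := ltnP e k; first by rewrite coef_exp_low // oppr0; exact: pencil_ideal0.
apply/pencil_idealN/(pencil_top N1 size_q coprime_grad top_grad) => //.
by rewrite -gradedXn; exact: size_graded.
Qed.

Lemma n_neq0 : n%:R != 0 :> K. Proof. by rewrite pnatr_eq0. Qed.

(** Annihilation by both variables puts the components of degree below 2N into the ideal by descent.
    Those above 2N lie there anyway, and in degree 2N the Hessian spans the quotient. *)
Lemma milnor_soc_mclass p : milnor_soc (cl p) <-> exists c, cl p = cl (c%:MP * Hess Q).
Proof.
have HessE c e : (graded (c%:MP * Hess Q))`_e = if e == (N + N)%N then (c * n%:R) *: W else 0.
  rewrite gradedZ graded_Hess coefMXn coefC; case: (ltngtP e (N + N)%N) => [e1|e1|->].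
  - by rewrite scaler0.
  - by rewrite subn_eq0 leqNgt e1 scaler0.
  - by rewrite subnn -scaler_nat scalerA.
split=> [[_ H]|[c ->]].
  have kill (x : {mpoly K[2]}) : (graded x)`_0 = 0 -> forall e, J e (graded (p * x))`_e.
    by move=> x0; apply/mclass_eq0; rewrite mclassM; apply: H; apply/milnor_max_mclass.
  have JX e : J e.+1 ('X * (graded p)`_e).
    have x0 : (graded ('X_0 : {mpoly K[2]}))`_0 = 0 by rewrite graded_X0 coefMX.
    by have := kill _ x0 e.+1; rewrite gradedM graded_X0 mulrA coefMX /= coefMC mulrC.
  have J1 e : J e.+1 (graded p)`_e.
    have x0 : (graded ('X_1 : {mpoly K[2]}))`_0 = 0 by rewrite graded_X1 coefX.
    by have := kill _ x0 e.+1; rewrite gradedM graded_X1 coefMX.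
  have [c Jc] := pencil_span N1 size_q coprime_grad top_grad (size_graded p (N + N)).
  exists (c / n%:R); apply/eqP; rewrite -subr_eq0 -mclassB; apply/eqP/mclass_eq0 => e.
  rewrite gradedB coefB HessE; case: (ltngtP e (N + N)%N) => [e1|e1|->].
  - rewrite subr0; apply: (pencil_ideal_descent coprime_grad top_grad) => //.
    by rewrite /n; lia.
  - by rewrite subr0; apply: (pencil_top N1 size_q coprime_grad top_grad); rewrite ?size_graded.
  - by rewrite divfK ?n_neq0.
split=> [|y].
  by apply/milnor_max_mclass; rewrite HessE ltn_eqF // addn_gt0 N1.
have [r ->] := mclass_surj y; move=> /milnor_max_mclass r0.
rewrite -mclassM; apply/mclass_eq0 => e.
have [e1|e1] := ltnP (N + N) e.
  by apply: (pencil_top N1 size_q coprime_grad top_grad); rewrite ?size_graded.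
rewrite -mulrA gradedZ gradedM graded_Hess mulrAC coefMXn coefCM.
rewrite (_ : (if _ then _ else _) = 0) ?scaler0; first exact: pencil_ideal0.
by rewrite (eqP (e1 : e - (N + N) == 0)%N) r0 mulr0; case: ifP.
Qed.

Lemma mclass_Hess_inj c c' : cl (c%:MP * Hess Q) = cl (c'%:MP * Hess Q) -> c = c'.
Proof.
move=> /eqP; rewrite -subr_eq0 -mclassB -mulrBl -mpolyCB => /eqP/mclass_eq0/(_ (N + N)%N).
rewrite gradedZ graded_Hess coefMXn ltnn subnn coefC eqxx -scaler_nat scalerA => JW.
apply/eqP; rewrite -subr_eq0; apply/negP => /negP cc.
apply: (wronskian_notin N1 size_q coprime_grad top_grad).
have nz : (c - c') * n%:R != 0 by rewrite mulf_neq0 ?n_neq0.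
by rewrite -[wronskian _ _]scale1r -(mulVf nz) -scalerA; exact: pencil_idealZ.
Qed.

(** The choice in [omega] needs a witness: the function reading off the coefficient of the
    Hessian. *)
Lemma omega_is_socle_form : is_socle_form (@omega K m hm Q).
Proof.
pose w (x : milnor hm Q) : K := xget 0 [set c | x = cl (c%:MP * Hess Q)]%classic.
have wE c : w (cl (c%:MP * Hess Q)) = c.
  rewrite /w; case: xgetP => [c' _ /mclass_Hess_inj //|].
  by move=> /(_ c); case.
suff sw : is_socle_form w by apply: (xgetPex (fun=> 0) (P := [set w | is_socle_form w]%classic)); exists w.
have socP x : milnor_soc x -> exists c, x = cl (c%:MP * Hess Q).
  by have [p ->] := mclass_surj x; move/milnor_soc_mclass.
split.
- move=> c x y /socP[a ->] /socP[b ->]; rewrite -mclassM -mclassD !wE.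
  have -> : c%:MP * (a%:MP * Hess Q) + b%:MP * Hess Q = (c * a + b)%:MP * Hess Q.
    by rewrite mpolyCD mpolyCM; ring.
  by rewrite wE.
- split=> // [x y|c _].
    by rewrite !inE => /socP[a ->] /socP[b ->]; rewrite !wE => ->.
  by exists (cl (c%:MP * Hess Q)); [apply/milnor_soc_mclass; exists c|rewrite wE].
- by rewrite -[Hess Q]mul1r -[1]/(1%:MP) wE.
Qed.

(** The functional T_F of the associated form F. *)
Definition socle_pairing h : K := omega (cl (hform (N + N) h)).

Lemma hform_soc h : (size h <= (N + N).+1)%N -> milnor_soc (cl (hform (N + N) h)).
Proof.
move=> sh; apply/milnor_soc_mclass.
have [c Jc] := pencil_span N1 size_q coprime_grad top_grad sh.
exists (c / n%:R); apply/eqP; rewrite -subr_eq0 -mclassB; apply/eqP/mclass_eq0 => e.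
rewrite gradedB coefB gradedZ graded_Hess graded_hform // !coefMXn !coefC.
case: (ltngtP e (N + N)%N) => [e1|e1|->].
- by rewrite scaler0 subrr; exact: pencil_ideal0.
- by rewrite subn_eq0 leqNgt e1 scaler0 subrr; exact: pencil_ideal0.
- by rewrite subnn eqxx -scaler_nat scalerA divfK ?n_neq0.
Qed.

Lemma omega0 : @omega K m hm Q 0 = 0.
Proof.
have [lin _ _] := omega_is_socle_form.
have s0 : milnor_soc (0 : milnor hm Q).
  by rewrite -mclass0; apply/milnor_soc_mclass; exists 0; rewrite mpolyC0 mul0r.
by move/eqP: (lin 1 _ _ s0 s0); rewrite mulr0 addr0 mul1r -subr_eq0 opprD addrA subrr sub0r oppr_eq0 => /eqP.
Qed.

Lemma socle_pairing_linear c h h' : (size h <= (N + N).+1)%N -> (size h' <= (N + N).+1)%N ->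
  socle_pairing (c *: h + h') = c * socle_pairing h + socle_pairing h'.
Proof.
move=> sh sh'; have [lin _ _] := omega_is_socle_form.
by rewrite /socle_pairing hform_linear mclassD mclassM lin //; exact: hform_soc.
Qed.

Lemma socle_pairing_eq0 h : (size h <= (N + N).+1)%N -> socle_pairing h = 0 <-> J (N + N) h.
Proof.
move=> sh; have [_ [_ inj _] _] := omega_is_socle_form.
rewrite /socle_pairing; split=> [e|Jh]; last first.
  rewrite (_ : cl _ = 0) ?omega0 //; apply/mclass_eq0 => e.
  rewrite graded_hform // coefMXn coefC; case: (ltngtP e (N + N)%N) => [e1|e1|->].
  - exact: pencil_ideal0.
  - by rewrite subn_eq0 leqNgt e1; exact: pencil_ideal0.
  - by rewrite subnn.
have /mclass_eq0/(_ (N + N)%N) : cl (hform (N + N) h) = 0.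
  apply: inj; rewrite ?inE ?omega0 //; first exact: hform_soc.
  by rewrite -mclass0; apply/milnor_soc_mclass; exists 0; rewrite mpolyC0 mul0r.
by rewrite graded_hform // coefMXn ltnn subnn coefC.
Qed.

Definition socle_coef k := socle_pairing 'X^(N + N - k).

Lemma apolar_socle_coef h : (size h <= (N + N).+1)%N ->
  apolar (N + N) socle_coef h = socle_pairing h.
Proof.
move=> sh; rewrite [in RHS](poly_rev_expand sh).
suff [_ e] : (size (\sum_(i < (N + N).+1) h`_(N + N - i) *: 'X^(N + N - i))%R <= (N + N).+1)%N /\
   \sum_(i < (N + N).+1) socle_coef i * h`_(N + N - i) =
   socle_pairing (\sum_(i < (N + N).+1) h`_(N + N - i) *: 'X^(N + N - i)) by [].
elim/big_rec2: _ => [|i y p _ [sp ->]].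
  by rewrite size_poly0; split=> //; apply/esym/socle_pairing_eq0; rewrite ?size_poly0 //; exact: pencil_ideal0.
have sX : (size ('X^(N + N - i) : {poly K}) <= (N + N).+1)%N by rewrite size_polyXn ltnS leq_subr.
split; last by rewrite socle_pairing_linear // mulrC.
rewrite (leq_trans (size_polyD _ _)) // geq_max sp andbT.
exact: leq_trans (size_scale_leq _ _) sX.
Qed.

Lemma omega_linear_power (z : 'rV[K]_2) :
  omega ((cl (z 0 0)%:MP * cl 'X_0 + cl (z 0 1)%:MP * cl 'X_1) ^+ (2 * N)) =
  apolar (N + N) socle_coef (linpoly z ^+ (N + N)).
Proof.
have sl := size_linear_exp_leq (N + N) (size_linpoly z).
rewrite apolar_socle_coef // /socle_pairing mul2n -addnn -!mclassM -mclassD.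
have -> k p : cl p ^+ k = cl (p ^+ k).
  by elim: k => [|k IH]; rewrite ?mclass1 // !exprS mclassM IH.
congr (omega (cl _)); apply: dhomogE2 => //.
rewrite gradedXn gradedD !gradedM graded_X0 graded_X1 {1 2}/graded !mmapC /=.
rewrite mulrA -mulrDl exprMn rmorphXn /=; congr (_ ^+ _ * _).
by rewrite /linpoly addrC -rmorphM -rmorphD mul_polyC.
Qed.

(** The form with coefficients [socle_coef] meets the defining condition, so the default 0 in
    [assoc_form] is not taken. *)
Lemma assoc_form_feval z :
  feval (assoc_form hm Q : {mpoly K[2]}) z = apolar (N + N) socle_coef (linpoly z ^+ (N + N)).
Proof.
rewrite -omega_linear_power /assoc_form; case: xgetP => [P _ /= -> //|H].
have dh : hform (2 * N) (dehom (2 * N) socle_coef) \is (2 * N).-homog by exact: hform_dhomog.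
case: (H (DHomog dh)) => /= y; rewrite omega_linear_power /feval meval_hform_dehom.
by rewrite mul2n -addnn.
Qed.

Lemma apolar_assoc_form h : apolar (N + N) (bcoef (assoc_form hm Q)) h = apolar (N + N) socle_coef h.
Proof.
apply: apolar_eq; apply: apolar_ext => z; rewrite -assoc_form_feval feval_apolar.
by move: (bcoef _) => a; rewrite mul2n addnn.
Qed.

Lemma apolar_assoc_form_eq0 h : (size h <= (N + N).+1)%N ->
  apolar (N + N) (bcoef (assoc_form hm Q)) h = 0 <-> J (N + N) h.
Proof. by move=> sh; rewrite apolar_assoc_form apolar_socle_coef //; exact: socle_pairing_eq0. Qed.

(** By duality a form of degree N orthogonal to all others lies in the ideal, whose generators have
    degree N+1; so it is 0. *)
Lemma assoc_form_hankel : \det (hankel N (bcoef (assoc_form hm Q))) != 0.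
Proof.
apply: hankel_unit => u su H.
apply: (@pencil_ideal_small _ n f g N) => //.
exact: (pencil_duality N1 size_q coprime_grad top_grad apolar_assoc_form_eq0 erefl su H).
Qed.

Lemma assoc_form_two_roots : two_roots N (bcoef (assoc_form hm Q)).
Proof.
move=> M r uM rE.
(* Multiplicity N makes the N+1-st power of the linear form orthogonal to degree N-1, as
   [pencil_second_root] requires. *)
have kill0 : forall j, (j < N.-1.+1)%N -> apolar (N.+1 + N.-1) (bcoef (assoc_form hm Q))
    (linpoly (row 0 M) ^+ (N.+1 + N.-1 - j) * linpoly (row 1 M) ^+ j) = 0.
  rewrite addSnnS prednK // => j jN; apply: apolar_root rE _ jN; lia.
have H0 h : (size h <= N)%N -> apolar (N + N) (bcoef (assoc_form hm Q)) (linpoly (row 0 M) ^+ n * h) = 0.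
  by have := apolar_mul0 uM kill0; rewrite addSnnS prednK // => /(_ h).
have rs : ((row 0 M) 0 0 != 0) || ((row 0 M) 0 1 != 0).
  rewrite !mxE -negb_and; move: uM; rewrite unitmx2; apply: contra => /andP[/eqP-> /eqP->].
  by rewrite !mul0r subrr.
have [r' [s' [nz H1]]] :=
  pencil_second_root N1 size_q coprime_grad top_grad apolar_assoc_form_eq0 rs H0.
pose M' := mx22 ((row 0 M) 0 0) ((row 0 M) 0 1) r' s'.
have uM' : M' \in unitmx by rewrite unitmx2 !mxE /=; move: nz; rewrite !mxE mulrC (mulrC r').
apply: (two_point_form N1 uM') => -[[|[|//]] i2] h sh.
  rewrite (_ : row _ _ = row 0 M) ?H0 //.
  by apply/rowP; case=> [[|[|//]] j2]; rewrite !mxE /=; congr (M _ _); apply/val_inj.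
have -> : linpoly (row (Ordinal i2) M') = s'%:P + r' *: 'X by rewrite /linpoly !mxE.
exact: H1.
Qed.

End MilnorIdeal.

(** * Closedness of the orbit *)

Section Orbit.
Variable K : numClosedFieldType.
Implicit Types a b : nat -> K.

Lemma equivalent_hankel N a b : \det (hankel N a) != 0 -> equivalent (N + N) a b ->
  \det (hankel N b) != 0.
Proof.
move=> da [M uM H]; suff -> : hankel N b = hankel N (twist (N + N) a M) by exact: hankel_twist_unit.
apply/matrixP => i j; rewrite !mxE.
apply: (@apolar_ext K (N + N)) => [z|]; last by have := ltn_ord i; have := ltn_ord j; lia.
by rewrite H apolar_twist.
Qed.

Lemma GL2_orbit_equivalent d (P P' : binform K d) :
  GL2_orbit P P' <-> equivalent d (bcoef P) (bcoef P').
Proof.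
split=> [[C uC H]|[M uM H]].
  exists (invmx C)^T; first by rewrite unitmx_tr unitmx_inv.
  by move=> z; rewrite -!feval_apolar.
exists (invmx M^T); first by rewrite unitmx_inv unitmx_tr.
by move=> z; rewrite invmxK trmxK !feval_apolar.
Qed.

(** The degree is a variable because associated forms have degree [2 * (m - 2)], while the pairing
    is set up in degree [N + N]. *)
Lemma zariski_closed_orbit N d (P : binform K d) : d = (N + N)%N -> (0 < N)%N ->
  \det (hankel N (bcoef P)) != 0 -> two_roots N (bcoef P) ->
  zariski_closed_in [set P' : binform K d | \det (hankel N (bcoef P')) != 0]%classic (GL2_orbit P).
Proof.
move=> dN; subst d => N0 hP tP.
(* This is the Zariski closure of the orbit; by [orbit_separation] it adds no form of non-zero
   catalecticant. *)
exists [set P' : binform K (N + N) | forall f : {mpoly K[(N + N).+1]},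
  (forall P1, GL2_orbit P P1 -> f.@[fun j => bcoef P1 j] = 0) -> f.@[fun j => bcoef P' j] = 0]%classic.
  by exists [set f : {mpoly K[(N + N).+1]} | forall P1, GL2_orbit P P1 -> f.@[fun j => bcoef P1 j] = 0]%classic.
apply/seteqP; split=> [P' oP'|P' [/= ZP' hP']].
  split=> /= [f|]; first exact.
  by apply: equivalent_hankel hP _; apply/GL2_orbit_equivalent.
apply/GL2_orbit_equivalent; apply: contrapT => nP'.
have [f [fP' fP]] := orbit_separation N0 hP hP' tP nP'.
by move/eqP: fP'; apply; apply: ZP' => P1 /GL2_orbit_equivalent; exact: fP.
Qed.

Lemma associated_orbit_closed m (hm : (3 <= m)%N) (Q : binform K m) :
  X2 K m Q -> zariski_closed_in (Y2 K (m - 2)) (GL2_orbit (assoc_form hm Q)).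
Proof.
move=> XQ; apply: (@zariski_closed_orbit (m - 2)).
- by rewrite mul2n addnn.
- by lia.
- exact: assoc_form_hankel.
- exact: assoc_form_two_roots.
Qed.

End Orbit.

Theorem corollary5p4 (R : realType) (m : nat) (hm : (3 <= m)%N)
    (Q : binform R[i] m) :
  X2 R[i] m Q ->
  zariski_closed_in (Y2 R[i] (m - 2)) (GL2_orbit (assoc_form hm Q)).
Proof. exact: associated_orbit_closed. Qed.
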